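(* The set $\mathcal O=\mathcal Q\cup S_\gamma^G$ is a $(q+1)$-ovoid of $\mathcal W(5,q)$, i.e. every generator (totally isotropic plane) of $\mathcal W(5,q)$ contains exactly $q+1$ points of $\mathcal O$. It has $(q+1)(q^3+1)$ points.
   Context: Let $q$ be an even prime power and $\mathrm{PG}(5,q^2)$ have homogeneous coordinates $(X_1,\dots,X_6)$, points written as column vectors. Let $\Sigma$ be the set of points having a coordinate vector $(\alpha,\alpha^q,\delta_0,\beta,\beta^q,\delta_1)$ with $\alpha,\beta\in\mathbb F_{q^2}$, $\delta_0,\delta_1\in\mathbb F_q$ (a Baer subgeometry $\cong\mathrm{PG}(5,q)$). Let $\mathcal Q=\Sigma\cap\{X_6=0,\ X_3^2+X_1X_5+X_2X_4=0\}=\{(\alpha,\alpha^q,\sqrt{\alpha\beta^q+\alpha^q\beta},\beta,\beta^q,0):(\alpha,\beta)\ne(0,0)\}$. Fix $\omega\in\mathbb F_{q^2}\setminus\mathbb F_q$ with $\omega+\omega^q=1$ and let $h(X,Y)=\omega X_1Y_4^q+\omega^qX_1Y_6^q+\omega^qX_2Y_5^q+\omega X_2Y_6^q+X_3Y_6^q+\omega^qX_4Y_1^q+\omega X_5Y_2^q+\omega X_6Y_1^q+\omega^qX_6Y_2^q+X_6Y_3^q$. Restricted to $\Sigma$, $P\perp R\iff h(P,R)=0$ defines a symplectic polarity $\perp$ of $\Sigma\cong\mathrm{PG}(5,q)$; $\mathcal W(5,q)$ is the associated symplectic polar space. For $a,b,c,d\in\mathbb F_{q^2}$ with $ad+bc=1$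 let $M_{a,b,c,d}$ be the $6\times6$ matrix with rows $(a^2,0,0,0,c^2,\tfrac{c(a+c\omega^q)}{\omega})$, $(0,a^{2q},0,c^{2q},0,\tfrac{c^q(a^q+c^q\omega)}{\omega^q})$, $(ab,a^qb^q,1,c^qd^q,cd,\tfrac{d(a+c\omega^q)}{\omega}+\tfrac{d^q(a^q+c^q\omega)}{\omega^q}+\tfrac{1}{\omega^{q+1}})$, $(0,b^{2q},0,d^{2q},0,\tfrac{d^q(b^q+d^q\omega)+\omega}{\omega^q})$, $(b^2,0,0,0,d^2,\tfrac{d(b+d\omega^q)+\omega^q}{\omega})$, $(0,0,0,0,0,1)$, and let $G\cong\mathrm{PSL}(2,q^2)$ be the group of projectivities $X\mapsto M_{a,b,c,d}X$. Fix $\gamma\in\mathbb F_{q^2}$ with $X^2+X+\gamma$ irreducible over $\mathbb F_{q^2}$, let $S_\gamma=\left(\frac{\gamma}{\omega},\frac{\gamma^q}{\omega^q},\frac{\omega^q\gamma}{\omega}+\frac{\omega\gamma^q}{\omega^q},1,1,1\right)$ and $S_\gamma^G$ its $G$-orbit. An $m$-ovoid of $\mathcal W(5,q)$ is a set of points meeting every generator in exactly $m$ points. *)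

(* Defs.v *)
From HB Require Import structures.
From mathcomp Require Import all_boot all_order all_algebra all_field.
Set Implicit Arguments. Unset Strict Implicit. Unset Printing Implicit Defensive.
Import GRing.Theory.
Local Open Scope ring_scope.

(* Coordinates X1..X6 of PG(5,q^2) are the indices 0..5 of a column vector
   'cV[L]_6.  A projective point is represented canonically by the row space
   <<v^T>>%MS of a nonzero coordinate vector v. *)

Section Defs.
Variables (L : finFieldType) (q : nat) (w : L).

Definition cv6 (s : seq L) : 'cV[L]_6 := \col_(i < 6) nth 0 s i.

Definition ptv (v : 'cV[L]_6) : 'M[L]_6 := <<v^T>>%MS.

Definition sigma_vec (v : 'cV[L]_6) : bool :=
  [&& v 1 0 == (v 0 0) ^+ q, v 4 0 == (v 3 0) ^+ q,
      (v 2 0) ^+ q == v 2 0 & (v 5 0) ^+ q == v 5 0].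

Definition Sigma : {set 'M[L]_6} :=
  [set ptv v | v in [set v : 'cV[L]_6 | (v != 0) && sigma_vec v]].

Definition Qset : {set 'M[L]_6} :=
  [set ptv v | v in [set v : 'cV[L]_6 | [&& v != 0, sigma_vec v, v 5 0 == 0 &
        (v 2 0) ^+ 2 + v 0 0 * v 4 0 + v 1 0 * v 3 0 == 0]]].

Definition hform (x y : 'cV[L]_6) : L :=
  let X i := x (inord i) 0 in let Y i := (y (inord i) 0) ^+ q in
  w * X 0 * Y 3 + w ^+ q * X 0 * Y 5 + w ^+ q * X 1 * Y 4 + w * X 1 * Y 5
  + X 2 * Y 5 + w ^+ q * X 3 * Y 0 + w * X 4 * Y 1 + w * X 5 * Y 0
  + w ^+ q * X 5 * Y 1 + X 5 * Y 2.

(* A plane of Sigma: the L-span of three L-independent points of Sigma; its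
   point set (as points of Sigma = PG(5,q)) is the set of points of Sigma
   lying in that span.  A generator of W(5,q) is a totally isotropic plane. *)
Definition span3 (u1 u2 u3 : 'cV[L]_6) : 'M[L]_(3, 6) :=
  col_mx (u1^T) (col_mx (u2^T) (u3^T)).

Definition generator (S : {set 'M[L]_6}) : Prop :=
  exists u1 u2 u3 : 'cV[L]_6,
    [/\ [&& sigma_vec u1, sigma_vec u2 & sigma_vec u3],
        \rank (span3 u1 u2 u3) = 3%N,
        (forall x y : 'cV[L]_6, (x^T <= span3 u1 u2 u3)%MS ->
            (y^T <= span3 u1 u2 u3)%MS -> hform x y = 0) &
        S = [set P in Sigma | (P <= span3 u1 u2 u3)%MS]].

Definition m_ovoid (m : nat) (O : {set 'M[L]_6}) : Prop :=
  O \subset Sigma /\ forall S, generator S -> #|O :&: S| = m.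

Definition Mabcd (a b c d : L) : 'M[L]_6 :=
  let wq := w ^+ q in
  let rows := [::
    [:: a ^+ 2; 0; 0; 0; c ^+ 2; c * (a + c * wq) / w];
    [:: 0; a ^+ (2 * q); 0; c ^+ (2 * q); 0; c ^+ q * (a ^+ q + c ^+ q * w) / wq];
    [:: a * b; a ^+ q * b ^+ q; 1; c ^+ q * d ^+ q; c * d;
        d * (a + c * wq) / w + d ^+ q * (a ^+ q + c ^+ q * w) / wq + 1 / w ^+ q.+1];
    [:: 0; b ^+ (2 * q); 0; d ^+ (2 * q); 0; (d ^+ q * (b ^+ q + d ^+ q * w) + w) / wq];
    [:: b ^+ 2; 0; 0; 0; d ^+ 2; (d * (b + d * wq) + wq) / w];
    [:: 0; 0; 0; 0; 0; 1]] in
  \matrix_(i < 6, j < 6) nth 0 (nth [::] rows i) j.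

Definition Gorbit (v : 'cV[L]_6) : {set 'M[L]_6} :=
  [set ptv (Mabcd p.1.1.1 p.1.1.2 p.1.2 p.2 *m v) |
     p in [set p : L * L * L * L | p.1.1.1 * p.2 + p.1.1.2 * p.1.2 == 1]].

Definition Sgamma (g : L) : 'cV[L]_6 :=
  cv6 [:: g / w; g ^+ q / w ^+ q; w ^+ q * g / w + w * g ^+ q / w ^+ q; 1; 1; 1].

Definition Oset (g : L) : {set 'M[L]_6} := Qset :|: Gorbit (Sgamma g).

End Defs.

(* Main.v *)
Require Import Defs.
From HB Require Import structures.
From mathcomp Require Import all_boot all_order all_algebra all_field.
From mathcomp Require Import zify.
From Stdlib Require Import Ring.
Set Implicit Arguments. Unset Strict Implicit. Unset Printing Implicit Defensive.
Import GRing.Theory.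
Local Open Scope ring_scope.

(** Let K be the subfield of order q of L and write a vector of Sigma as
    (alpha, alpha^q, d, beta, beta^q, h).  With A = w alpha and
    B = w beta^q + w^q h, the group acts on (A, h, B) as SL(2, q^2) acts on the
    binary quadratic forms A X^2 + h X Y + B Y^2, and a point of Sigma lies on O
    iff some s in L satisfies

      s^2 + s h + g h^2 = A B   and   d = Tr((s + g h)/w) + Tr(g) h,

    the points of Q being those with h = 0.

    Let U be a generator.  If h = 0 on U, then U contains the pole N of the
    hyperplane h = 0, and every line of U through N carries exactly one point
    of Q.  Otherwise, eliminating s shows that O meets U in the zeros of a
    ternary quadratic form E over K.  Because X^2 + X + g has no root in L, the
    form (A R + B P)^2 + P R is anisotropic at affine points of O, and this
    forces E to be nonzero at its nucleus or to be the square of a nonzero linear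
    form.  Either way there is a vector m with E(v + l m) = E(v) + l^2 f and
    f <> 0, so every line through m carries exactly one zero of E and E has
    q^2 zero vectors, that is, q + 1 projective zeros. *)

Lemma card_fibers (T T' : finType) (f : T -> T') (A : {set T}) k :
  (forall x, x \in A -> #|[set y in A | f y == f x]| = k) -> #|A| = (k * #|f @: A|)%N.
Proof.
move=> hk; rewrite -sum1_card (partition_big_imset f) /=.
rewrite mulnC -sum_nat_const; apply: eq_bigr => _ /imsetP[x xA ->].
by rewrite -(hk x xA) -sum1_card; apply: eq_bigl => y; rewrite !inE.
Qed.

(** * Arithmetic in characteristic 2 *)

Section Ovoid.
Variables (L : finFieldType) (q e : nat) (w g : L).
Hypotheses (q_pow2 : q = (2 ^ e.+1)%N) (card_L : #|L| = (q ^ 2)%N).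
Hypotheses (w_trace : w + w ^+ q = 1) (g_noroot : forall x : L, x ^+ 2 + x + g != 0).

Lemma char2 : (1 + 1 : L) = 0.
Proof.
apply: (@pcharf0 L 2); apply: (@card_finPcharP L 2 (e.+1 * 2)) => //.
by rewrite card_L q_pow2 expnM.
Qed.

(** The coefficients used by [ring] are booleans read as the field of two elements, so that its
    normal forms are taken modulo 2. *)
Definition F2_embed (b : bool) : L := if b then 1 else 0.
Lemma oppr_char2 (x : L) : - x = x.
Proof. by apply: (addrI x); rewrite subrr -{1}[x]mulr1 -{2}[x]mulr1 -mulrDr char2 mulr0. Qed.

(* Reification by [ring] is syntactic, whereas the structure arguments of the
   MathComp operations vary with the way a term was built: these wrappers give
   every operation a single form. *)
Definition ladd (x y : L) : L := x + y.
Definition lmul (x y : L) : L := x * y.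
Definition lsub (x y : L) : L := x - y.
Definition lopp (x : L) : L := - x.
Definition lexp (x : L) (n : nat) : L := x ^+ n.
Definition linv (x : L) : L := x^-1.
Definition lzero : L := 0.
Definition lone : L := 1.
Lemma char2_ring_theory : ring_theory lzero lone ladd lmul lsub lopp (@eq L).
Proof. split=> *; rewrite /ladd /lmul /lsub /lopp ?add0r ?mul1r ?addrA ?mulrA ?subrr //;
  by [apply: addrC|apply: mulrC|rewrite mulrDl]. Qed.
Lemma F2_ring_morph :
  ring_morph lzero lone ladd lmul lsub lopp (@eq L)
    false true xorb andb xorb id Bool.eqb F2_embed.
Proof. split=> //; rewrite /ladd /lmul /lsub /lopp.
- by case; case; rewrite /= ?addr0 ?add0r ?char2.
- by case; case; rewrite /= ?subr0 ?sub0r ?subrr ?oppr_char2.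
- by case; case; rewrite /= ?mulr0 ?mulr1 ?mul0r.
- by case; rewrite /= ?oppr_char2 ?oppr0.
- by case; case. Qed.
Lemma char2_power_theory : power_theory lone lmul (@eq L) nat_of_bin lexp.
Proof.
split=> x [|n] //=; rewrite /lexp /lmul; elim: n => [n IH|n IH|] //=.
- by rewrite -IH -exprD -exprS NatTrec.doubleE addnn.
- by rewrite -IH -exprD NatTrec.doubleE addnn.
Qed.
Ltac F2_const t := match t with lzero => constr:(false)
 | lone => constr:(true)
 | _ => constr:(InitialRing.NotConstant) end.
Ltac numeral t := match t with O => idtac | S ?n => numeral n end.
Ltac nat_const t := match t with
 | _ => let _ := match goal with _ => numeral t end in
     let v := eval vm_compute in (bin_of_nat t) in constr:(v)
 | _ => constr:(InitialRing.NotConstant) end.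
Add Ring Lr : char2_ring_theory
  (morphism F2_ring_morph, constants [F2_const], power_tac char2_power_theory [nat_const]).
Ltac normalize_ops t := match t with
 | @GRing.add _ ?a ?b => let a' := normalize_ops a in
     let b' := normalize_ops b in constr:(ladd a' b')
 | @GRing.mul _ ?a ?b => let a' := normalize_ops a in
     let b' := normalize_ops b in constr:(lmul a' b')
 | @GRing.opp _ ?a => let a' := normalize_ops a in constr:(lopp a')
 | @GRing.exp _ ?a ?n => let a' := normalize_ops a in constr:(lexp a' n)
 | @GRing.natmul _ ?a 2 => let a' := normalize_ops a in constr:(ladd a' a')
 | @GRing.inv _ ?a => let a' := normalize_ops a in constr:(linv a')
 | @fun_of_matrix _ ?m ?k ?A ?i ?j => constr:(@fun_of_matrix L m k A i j)
 | @GRing.zero _ => constr:(lzero)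
 | @GRing.one _ => constr:(lone)
 | _ => constr:(t : L)
end.
Ltac char2_ring := intros;
 match goal with |- @eq _ ?a ?b => let a' := normalize_ops a in
     let b' := normalize_ops b in change (@eq L a' b'); ring end.

Lemma addxx (x : L) : x + x = 0. Proof. char2_ring. Qed.
Lemma addr_eq0_char2 (x y : L) : x + y = 0 -> x = y.
Proof. by move/eqP; rewrite addr_eq0 oppr_char2 => /eqP. Qed.

(* In characteristic 2 an equation x = y is certified by expressing x + y as a
   combination of the sums a + b over the hypotheses a = b. *)
Lemma lincomb1 (a b k x y : L) : a = b -> x + y = k * (a + b) -> x = y.
Proof. by move=> ->; rewrite addxx mulr0 => /addr_eq0_char2. Qed.
Lemma lincomb2 (a b k a' b' k' x y : L) : a = b -> a' = b' ->
  x + y = k * (a + b) + k' * (a' + b') -> x = y.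
Proof. by move=> -> ->; rewrite !addxx !mulr0 addr0 => /addr_eq0_char2. Qed.
Lemma lincomb3 (a b k a' b' k' a2 b2 k2 x y : L) : a = b -> a' = b' -> a2 = b2 ->
  x + y = k * (a + b) + k' * (a' + b') + k2 * (a2 + b2) -> x = y.
Proof. by move=> -> -> ->; rewrite !addxx !mulr0 !addr0 => /addr_eq0_char2. Qed.

Lemma lincomb4 (a b k a' b' k' a2 b2 k2 a3 b3 k3 x y : L) :
  a = b -> a' = b' -> a2 = b2 -> a3 = b3 ->
  x + y = k * (a + b) + k' * (a' + b') + k2 * (a2 + b2) + k3 * (a3 + b3) -> x = y.
Proof. by move=> -> -> -> ->; rewrite !addxx !mulr0 !addr0 => /addr_eq0_char2. Qed.

Lemma sqrD (x y : L) : (x + y) ^+ 2 = x ^+ 2 + y ^+ 2. Proof. char2_ring. Qed.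
Lemma sqr_inj (x y : L) : x ^+ 2 = y ^+ 2 -> x = y.
Proof.
move=> h; apply: addr_eq0_char2; apply/eqP; rewrite -sqrf_eq0 sqrD h; apply/eqP; exact: addxx.
Qed.

Lemma pow2D k (x y : L) : (x + y) ^+ (2 ^ k) = x ^+ (2 ^ k) + y ^+ (2 ^ k).
Proof. by elim: k => [|k IH]; rewrite ?expr1 // expnSr !exprM IH sqrD. Qed.

(** * The extension L/K *)

Definition bar (x : L) := x ^+ q.
(** The inverse of the Frobenius map: [2 ^ (e + e.+1)] is half of [q ^ 2], the order of L. *)
Definition sqrt2 (x : L) := locked (x ^+ (2 ^ (e + e.+1))).
Lemma barD x y : bar (x + y) = bar x + bar y.
Proof. by rewrite /bar q_pow2 pow2D. Qed.
Lemma barM x y : bar (x * y) = bar x * bar y. Proof. exact: exprMn. Qed.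
Lemma barK x : bar (bar x) = x.
Proof. by rewrite /bar -exprM mulnn -card_L expf_card. Qed.
Lemma bar1 : bar 1 = 1. Proof. exact: expr1n. Qed.
Lemma bar0 : bar 0 = 0. Proof. by rewrite /bar q_pow2 expr0n expn_eq0. Qed.
Lemma barX x k : bar (x ^+ k) = bar x ^+ k. Proof. exact: exprAC. Qed.
Lemma barV x : bar x^-1 = (bar x)^-1. Proof. exact: exprVn. Qed.
Lemma sqrt2K x : sqrt2 x ^+ 2 = x.
Proof. by rewrite /sqrt2 -lock -exprM -expnSr -addSn addnn -muln2 expnM
  -q_pow2 -card_L expf_card. Qed.
Lemma bar_sqrt2 x : bar (sqrt2 x) = sqrt2 (bar x).
Proof. by apply: sqr_inj; rewrite -barX !sqrt2K. Qed.
Lemma bar_eq0 x : (bar x == 0) = (x == 0).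
Proof. by rewrite expf_eq0 q_pow2 expn_gt0. Qed.

Definition inK : pred L := fun x => bar x == x.
Lemma inKP x : reflect (bar x = x) (x \in inK). Proof. exact: eqP. Qed.
Lemma K0 : 0 \in inK. Proof. by apply/inKP/bar0. Qed.
Lemma K1 : 1 \in inK. Proof. by apply/inKP/bar1. Qed.
Lemma KD x y : x \in inK -> y \in inK -> x + y \in inK.
Proof. by move=> /inKP hx /inKP hy; apply/inKP; rewrite barD hx hy. Qed.
Lemma KM x y : x \in inK -> y \in inK -> x * y \in inK.
Proof. by move=> /inKP hx /inKP hy; apply/inKP; rewrite barM hx hy. Qed.
Lemma KX x k : x \in inK -> x ^+ k \in inK.
Proof. by move=> /inKP hx; apply/inKP; rewrite barX hx. Qed.
Lemma KV x : x \in inK -> x^-1 \in inK.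
Proof. by move=> /inKP hx; apply/inKP; rewrite barV hx. Qed.
Lemma Ksqrt2 x : x \in inK -> sqrt2 x \in inK.
Proof. by move=> /inKP hx; apply/inKP; rewrite bar_sqrt2 hx. Qed.
Definition tr x := x + bar x.
Lemma trK x : tr x \in inK.
Proof. by apply/inKP; rewrite /tr barD barK addrC. Qed.

Lemma bar_w : bar w = w + 1.
Proof. apply: (lincomb1 (k := 1) w_trace); rewrite -/(bar w); char2_ring. Qed.

(* Total isotropy puts the polar form P1 R2 + P2 R1 in theta^2 K, so the K-basis
   (theta^2, theta) of L is adapted to the conditions below. *)
Definition theta := locked (sqrt2 w).
Lemma theta2 : theta ^+ 2 = w. Proof. by rewrite /theta -lock sqrt2K. Qed.
Lemma bar_theta : bar theta = theta + 1.
Proof. by apply: sqr_inj; rewrite -barX theta2 bar_w sqrD theta2 expr1n. Qed.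
(** The norm of [theta] over K, because [bar theta = theta + 1]. *)
Definition mu := locked (theta ^+ 2 + theta).
Lemma muD : mu = theta ^+ 2 + theta. Proof. by rewrite /mu -lock. Qed.
Lemma muK : mu \in inK.
Proof. by apply/inKP; rewrite muD barD barX bar_theta; char2_ring. Qed.
Lemma theta_neq0 : theta != 0.
Proof.
apply/eqP => h; have := bar_theta; rewrite h bar0 add0r => /esym /eqP.
by rewrite oner_eq0.
Qed.

Lemma theta1_neq0 : theta + 1 != 0.
Proof. by rewrite -bar_theta bar_eq0 theta_neq0. Qed.
Lemma muE : mu = theta * (theta + 1). Proof. rewrite muD; char2_ring. Qed.
Lemma mu_neq0 : mu != 0.
Proof. by rewrite muE mulf_neq0 ?theta_neq0 ?theta1_neq0. Qed.
Lemma w_neq0 : w != 0. Proof. by rewrite -theta2 expf_neq0 ?theta_neq0. Qed.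

(** After division by [theta], the sum of the relation and its conjugate is [a = 0]. *)
Lemma theta_indep a b : a \in inK -> b \in inK -> theta ^+ 2 * a + theta * b = 0 -> a = 0 /\ b = 0.
Proof.
move=> /inKP ha /inKP hb e0.
have e1 : theta * a + b = 0.
  by apply: (mulfI theta_neq0); apply: (lincomb1 (k := 1) e0); char2_ring.
have e2 : (theta + 1) * a + b = 0.
  by rewrite -[RHS]bar0 -e1 barD barM bar_theta ha hb.
have a0 : a = 0 by apply: (lincomb2 (k := 1) (k' := 1) e1 e2); char2_ring.
by split=> //; rewrite -e1 a0; char2_ring.
Qed.

(** A K-linear functional on L whose kernel is [theta ^+ 2] K; it reads off the second coordinate
    over the basis, up to the factor [mu]. *)
Definition wtr x := x / w + bar x / bar w.
Lemma wtrE x : wtr x = tr (x / w). Proof. by rewrite /tr barM barV. Qed.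
Lemma wtrK x : wtr x \in inK. Proof. by rewrite wtrE trK. Qed.

Ltac inK := repeat first [assumption | apply: K0 | apply: K1 | apply: muK | apply: trK
  | apply: wtrK | apply: KM | apply: KX | apply: KV | apply: Ksqrt2 | apply: KD].

Lemma theta_decomp x : exists a b, [/\ a \in inK, b \in inK & x = theta ^+ 2 * a + theta * b].
Proof.
have ka : x + theta * tr x \in inK.
  apply/inKP; rewrite /tr !(barD, barM, barK) bar_theta; char2_ring.
(* Here x = k + [theta * tr x] with k in K, and 1 is [(theta ^+ 2 + theta) / mu]. *)
exists ((x + theta * tr x) / mu), ((x + theta * tr x) / mu + tr x); split.
- by inK.
- by inK.
apply: (mulfI mu_neq0).
set y := _ / mu.
have hy : mu * y = x + theta * tr x by rewrite /y mulrC divfK ?mu_neq0.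
apply: (lincomb1 (k := mu) hy). rewrite muD; char2_ring.
Qed.

Lemma wtrD x y : wtr (x + y) = wtr x + wtr y.
Proof. rewrite /wtr barD; char2_ring. Qed.
Lemma wtrZ a x : a \in inK -> wtr (a * x) = a * wtr x.
Proof. move=> /inKP ha; rewrite /wtr barM ha; char2_ring. Qed.
(** As [theta ^+ 2 = w], the first term contributes the trace of [a], which is 0; the trace of
    [1 / theta] is [1 / mu], since [theta] has trace 1 and norm [mu]. *)
Lemma wtr_theta a b : a \in inK -> b \in inK -> wtr (theta ^+ 2 * a + theta * b) = b / mu.
Proof.
move=> /inKP ha /inKP hb; rewrite /wtr !(barD, barM, barX) bar_w -theta2 bar_theta ha hb.
have -> : theta ^+ 2 + 1 = (theta + 1) ^+ 2 by char2_ring.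
apply: (mulfI mu_neq0); rewrite [RHS]mulrC divfK ?mu_neq0 // muE.
have hu := divff theta_neq0; have hv := divff theta1_neq0.
rewrite -!exprVn; set u := theta^-1 in hu *; set v := (theta + 1)^-1 in hv *.
have -> : (theta ^+ 2 * a + theta * b) * u ^+ 2 = a + b * u.
  apply: (lincomb1 (k := a * (theta * u + 1) + b * u) hu); char2_ring.
have -> : ((theta + 1) ^+ 2 * a + (theta + 1) * b) * v ^+ 2 = a + b * v.
  apply: (lincomb1 (k := a * ((theta + 1) * v + 1) + b * v) hv); char2_ring.
apply: (lincomb2 (k := (theta + 1) * b) (k' := theta * b) hu hv); char2_ring.
Qed.

Lemma wtr_eq0 x : wtr x = 0 -> exists2 c, c \in inK & x = theta ^+ 2 * c.
Proof.
have [a [b [ha hb ->]]] := theta_decomp x; rewrite wtr_theta // => /eqP.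
rewrite mulf_eq0 invr_eq0 (negPf mu_neq0) orbF => /eqP ->.
by exists a; rewrite // mulr0 addr0.
Qed.

Lemma w_decomp x : x + w * tr x \in inK.
Proof. by apply/inKP; rewrite /tr !(barD, barM, barK) bar_w; char2_ring. Qed.

(** Coordinates over the K-basis (1, w) identify L with K x K, so the square of this cardinal is
    [q ^ 2]. *)
Lemma card_K : #|inK| = q.
Proof.
pose f x := (x + w * tr x, tr x).
have fI : injective f.
  move=> x y [] e1 e2; move: e1; rewrite e2; exact: addIr.
have : [set f x | x in L] = setX [set x in inK] [set x in inK].
  apply/setP=> -[a b]; rewrite !inE /=; apply/imsetP/andP.
    by case=> x _ [-> ->]; split; [apply: w_decomp | apply: trK].
  case=> /inKP ha /inKP hb; exists (a + w * b) => //; rewrite /f.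
  have -> : tr (a + w * b) = b by rewrite /tr barD barM ha hb bar_w; char2_ring.
  by congr (_, _); char2_ring.
move/(congr1 (fun A : {set _} => #|A|)); rewrite card_imset // cardsX card_L !cardsE mulnn.
by move/eqP; rewrite eqn_exp2r // => /eqP.
Qed.

(** The preimage of K under x^2 + x is [S], the set of elements of trace 0 or 1, that is, the union
    of K and K + w. It has 2q elements and every fibre has two, so the image has q elements and is
    all of K. The solution is found in L, not necessarily in K. *)
Lemma K_artin_schreier c : c \in inK -> exists x, x ^+ 2 + x = c.
Proof.
move=> hc; pose f (x : L) := x ^+ 2 + x.
pose A := [set x in inK]; pose S := A :|: [set x + w | x in A].
have trS x : (x \in S) = (tr x == 0) || (tr x == 1).
  rewrite inE inE -/(_ \in inK); congr orb.
    by apply/inKP/eqP => [h|/addr_eq0_char2 /esym //]; rewrite /tr h addxx.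
  apply/imsetP/eqP => [[y + ->]|h].
    by rewrite inE => /inKP hy; rewrite /tr barD bar_w hy; char2_ring.
  exists (x + w); last by char2_ring.
  by rewrite inE; have := w_decomp x; rewrite h mulr1.
have fS x : (x \in S) = (f x \in inK).
  rewrite trS; have -> : (f x \in inK) = (tr x * (tr x + 1) == 0).
    apply/inKP/eqP => [h|h].
      by apply: (lincomb1 (k := 1) h); rewrite /f /tr barD barX; char2_ring.
    by apply: (lincomb1 (k := 1) h); rewrite /f /tr barD barX; char2_ring.
  rewrite mulf_eq0; congr orb; apply/eqP/eqP => [->|/addr_eq0_char2 //]; exact: addxx.
have h2 x : x \in S -> #|[set y in S | f y == f x]| = 2.
  move=> xS; rewrite (_ : [set _ in _ | _] = [set x; x + 1]).
    by rewrite cards2 -[X in X != _]addr0 (inj_eq (addrI x)) eq_sym oner_eq0.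
  apply/setP=> y; rewrite in_set2 [LHS]in_set fS; apply/andP/orP.
    case=> _ /eqP h; have /eqP : (y + x) * (y + (x + 1)) = 0.
      by apply: (lincomb1 (k := 1) h); rewrite /f; char2_ring.
    rewrite mulf_eq0 => /orP[] /eqP /addr_eq0_char2 ->; by [left|right].
  have h1 : f (x + 1) = f x by rewrite /f; char2_ring.
  by rewrite fS in xS; case=> /eqP ->; rewrite ?h1.
have cS : #|S| = (2 * q)%N.
  rewrite cardsU disjoint_setI0 ?cards0 ?subn0.
    by rewrite card_imset ?cardsE ?card_K ?mul2n ?addnn // => x y /addIr.
  rewrite -setI_eq0; apply/eqP/setP=> x; rewrite !inE; apply/andP => -[/eqP h /imsetP[y]].
  rewrite inE => /inKP hy e1; move: h; rewrite e1 barD hy bar_w => /addrI /eqP.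
  by rewrite -[X in _ == X]addr0 (inj_eq (addrI w)) oner_eq0.
have : f @: S = A.
  apply/eqP; rewrite eqEcard; apply/andP; split.
    by apply/subsetP=> _ /imsetP[x xS ->]; rewrite inE -/(_ \in inK) -fS.
  rewrite cardsE card_K -(leq_pmul2l (ltn0Sn 1)) -cS; by rewrite (card_fibers h2).
move/setP/(_ c); rewrite [RHS]inE -/(_ \in inK) hc => /imsetP[x _ ->].
by exists x.
Qed.

(** * The equation of O, and its restriction to a generator *)

(* For h = 0 this is the quadric Q.  For h = 1 the orbit point of the matrix
   (a, b, c, d) corresponds to s = a b g + c d + b c. *)
Definition on_curve (A B D h : L) := exists s,
  s ^+ 2 + s * h + g * h ^+ 2 = A * B /\ D = wtr (s + g * h) + tr g * h.

(** The ternary form E. Its first summand is a square and does not enter the polar form, so the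
    nucleus is [(m2, m1, c)]. *)
Definition conic (n1 n2 C0 c m1 m2 C2 x y h : L) :=
  (n1 * x + n2 * y + h * C0) ^+ 2 + c * x * y + h * (m1 * x + m2 * y) + h ^+ 2 * C2.

(* With sg = sqrt(P R) and t = s + sg, both conditions are linear in the
   coordinates of t over (theta^2, theta) up to squares: one coordinate must be
   h r, the other is determined, and substituting it leaves the conic. *)
Lemma on_curve_conic A0 B0 d r km kn P1 R1 s1 m1 n1 P2 R2 s2 m2 n2 C X Y h :
  r \in inK -> km \in inK -> kn \in inK -> m1 \in inK -> n1 \in inK ->
  m2 \in inK -> n2 \in inK -> C \in inK -> X \in inK -> Y \in inK -> h \in inK ->
  g + A0 * B0 = theta ^+ 2 * km + theta * kn ->
  r ^+ 2 = d + wtr g + tr g + kn / mu ->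
  s1 ^+ 2 = P1 * R1 -> s2 ^+ 2 = P2 * R2 -> P1 * R2 + P2 * R1 = (theta * C) ^+ 2 ->
  A0 * R1 + B0 * P1 + s1 = theta ^+ 2 * m1 + theta * n1 ->
  A0 * R2 + B0 * P2 + s2 = theta ^+ 2 * m2 + theta * n2 ->
  let x := X ^+ 2 in let y := Y ^+ 2 in
  on_curve (x * P1 + y * P2 + h * A0) (x * R1 + y * R2 + h * B0)
    (x * wtr (A0 * R1 + B0 * P1) + y * wtr (A0 * R2 + B0 * P2) + h * d) h <->
  conic n1 n2 (r ^+ 2 * mu + kn) (C ^+ 2) m1 m2 (r ^+ 2 * (1 + mu) + r + km) x y h = 0.
Proof.
move=> rK kmK knK m1K n1K m2K n2K CK XK YK hK ek er es1 es2 ec e1 e2 x y.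
have xK : x \in inK by apply: KX.
have yK : y \in inK by apply: KX.
(* The cross term of the product P R at the point is x y [(theta * C) ^+ 2]; it is a square because
   x and y are given as squares. *)
pose sg := x * s1 + y * s2 + theta * C * X * Y.
have sg2 : sg ^+ 2 = (x * P1 + y * P2) * (x * R1 + y * R2).
  apply: (lincomb3 (k := x ^+ 2) (k' := y ^+ 2) (k2 := x * y) es1 es2 ec).
  rewrite /sg /x /y; char2_ring.
pose z := x * (A0 * R1 + B0 * P1) + y * (A0 * R2 + B0 * P2).
pose Ym := x * m1 + y * m2; pose Yn := x * n1 + y * n2 + C * X * Y.
have YmK : Ym \in inK by rewrite /Ym; inK.
have YnK : Yn \in inK by rewrite /Yn; inK.
have ez : z + sg = theta ^+ 2 * Ym + theta * Yn.
  apply: (lincomb2 (k := x) (k' := y) e1 e2); rewrite /z /sg /Ym /Yn; char2_ring.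
have trz : x * wtr (A0 * R1 + B0 * P1) + y * wtr (A0 * R2 + B0 * P2) = wtr z.
  by rewrite /z [RHS]wtrD (wtrZ _ xK) (wtrZ _ yK).
(* The coordinates of the square come from theta^4 = (1 + mu) theta^2 + mu theta. *)
have eqn1 tm tn : (theta ^+ 2 * tm + theta * tn + sg) ^+ 2 + (theta ^+ 2 * tm + theta * tn + sg) * h
    + g * h ^+ 2 + (x * P1 + y * P2 + h * A0) * (x * R1 + y * R2 + h * B0) =
    theta ^+ 2 * ((1 + mu) * tm ^+ 2 + tn ^+ 2 + h * tm + h * Ym + h ^+ 2 * km)
    + theta * (mu * tm ^+ 2 + h * tn + h * Yn + h ^+ 2 * kn).
  apply: (lincomb3 (k := h) (k' := 1) (k2 := h ^+ 2) ez sg2 ek).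
  rewrite muD /z; char2_ring.
have eqn2 tm tn : tm \in inK -> tn \in inK ->
    mu * (x * wtr (A0 * R1 + B0 * P1) + y * wtr (A0 * R2 + B0 * P2) + h * d
      + (wtr (theta ^+ 2 * tm + theta * tn + sg + g * h) + tr g * h))
    = Yn + tn + h * (mu * r ^+ 2 + kn).
  move=> tmK tnK; rewrite trz [g * h]mulrC [wtr (_ + h * g)]wtrD
    [wtr (_ + sg)]wtrD (wtrZ _ hK) wtr_theta //.
  have := congr1 wtr ez; rewrite [wtr (z + sg)]wtrD wtr_theta // => ez'.
  apply: (lincomb2 (k := mu) (k' := h * mu) ez' er).
  have hY : Yn = mu * (Yn / mu) by rewrite mulrC divfK ?mu_neq0.
  have ht : tn = mu * (tn / mu) by rewrite mulrC divfK ?mu_neq0.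
  have hk : kn = mu * (kn / mu) by rewrite mulrC divfK ?mu_neq0.
  move: hY ht hk; set a := Yn / mu; set b := tn / mu; set k := kn / mu => hY ht hk.
  rewrite hY ht hk; char2_ring.
pose t := Yn + h * (r ^+ 2 * mu + kn).
have econic : conic n1 n2 (r ^+ 2 * mu + kn) (C ^+ 2) m1 m2 (r ^+ 2 * (1 + mu) + r + km) x y h
   = (1 + mu) * (h * r) ^+ 2 + t ^+ 2 + h * (h * r) + h * Ym + h ^+ 2 * km.
  rewrite /conic /t /Yn /Ym /x /y; char2_ring.
split.
  case=> s [h1 h2]; have [tm [tn [tmK tnK est]]] := theta_decomp (s + sg).
  have {}est : s = theta ^+ 2 * tm + theta * tn + sg by rewrite -est; char2_ring.
  have e3 := eqn2 _ _ tmK tnK; rewrite -est h2 addxx mulr0 in e3.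
  have e4 := eqn1 tm tn; rewrite -est h1 addxx in e4.
  have [] := theta_indep _ _ (esym e4); [rewrite /Ym /Yn; inK | rewrite /Yn; inK |].
  move=> e5 e6.
  have etn : tn = t by apply: (lincomb1 (k := 1) e3); rewrite /t; char2_ring.
  (* Once [tn = t], the [theta] coordinate reads mu tm^2 = mu (h r)^2; [r] is defined so that this
     right-hand side is a square. *)
  have etm : tm = h * r.
    apply: sqr_inj; apply: (mulfI mu_neq0).
    apply: (lincomb2 (k := 1) (k' := h) e6 etn); rewrite /t; char2_ring.
  by rewrite econic -etn -etm.
rewrite econic => e5.
have tK : t \in inK by rewrite /t; inK.
have hrK : h * r \in inK by inK.
exists (theta ^+ 2 * (h * r) + theta * t + sg); split; apply: addr_eq0_char2.
  rewrite eqn1 e5; rewrite /t; char2_ring.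
by apply: (mulfI mu_neq0); rewrite eqn2 // /t; char2_ring.
Qed.

(** If R is nonzero, rho = B^2 P / R satisfies rho^2 + rho = (A B)^2 = s^4 + s^2 + g^2, so the
    square root of rho + s^2 would be a root of X^2 + X + g. *)
Lemma anisotropic A B s P R : s ^+ 2 + s + g = A * B ->
  (A * R + B * P) ^+ 2 + P * R = 0 -> P = 0 /\ R = 0.
Proof.
move=> es ef.
have AB0 : A * B != 0 by rewrite -es g_noroot.
have [A0 B0] : A != 0 /\ B != 0 by move: AB0; rewrite mulf_eq0 negb_or => /andP.
have [R0|R0] := eqVneq R 0.
  move: ef; rewrite R0 !mulr0 add0r addr0 => /eqP.
  by rewrite sqrf_eq0 mulf_eq0 (negPf B0) => /eqP.
case/eqP: (g_noroot (sqrt2 (B ^+ 2 * P / R + s ^+ 2))).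
set rho := B ^+ 2 * P / R.
have hR : rho * R = B ^+ 2 * P by rewrite divfK.
have h1 : rho ^+ 2 + rho = (A * B) ^+ 2.
  apply: (mulIf (expf_neq0 2 R0)).
  apply: (lincomb2 (k := rho * R + B ^+ 2 * P + R) (k' := B ^+ 2) hR ef); char2_ring.
apply: sqr_inj; rewrite !sqrD sqrt2K.
apply: (lincomb1 (k := 1) h1).
rewrite -es; char2_ring.
Qed.

(** With y = 1 and x = (c / e1) X the equation becomes X^2 + X = e1 e2 / c^2. Its right-hand side is
    in K, so it is solvable in L. *)
Lemma binary_form_isotropic e1 e2 c : e1 \in inK -> e2 \in inK -> c \in inK -> c != 0 ->
  exists x y, [/\ e1 * x ^+ 2 + c * x * y + e2 * y ^+ 2 = 0 & (x, y) != (0, 0)].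
Proof.
move=> e1K e2K cK c0.
have [->|e10] := eqVneq e1 0.
  exists 1, 0; split; first by char2_ring.
  by rewrite xpair_eqE oner_eq0.
have [|x hx] := @K_artin_schreier (e1 * e2 / c ^+ 2); first by inK.
exists (c / e1 * x), 1; split; last by rewrite xpair_eqE oner_eq0 andbF.
have h1 : e1 / e1 = 1 by rewrite divff.
have h2 : e1 * e2 / c ^+ 2 * c ^+ 2 = e1 * e2 by rewrite divfK // expf_neq0.
apply: (mulfI e10); rewrite mulr0.
set f := e1^-1 in h1 *.
transitivity (c ^+ 2 * x ^+ 2 * (e1 * f) ^+ 2 + c ^+ 2 * x * (e1 * f) + e1 * e2).
  by char2_ring.
rewrite h1; apply: (lincomb2 (k := 1) (k' := c ^+ 2) h2 hx); char2_ring.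
Qed.

(* Were the nucleus on the conic, it would be an affine point of O, at which the
   form is anisotropic over L; restricted to K-combinations of the two vectors it
   is theta^2 times a binary form over K, which has a zero over L. *)
Lemma conic_nucleus_nonsingular A0 B0 d r km kn P1 R1 s1 m1 n1 P2 R2 s2 m2 n2 C :
  r \in inK -> km \in inK -> kn \in inK -> m1 \in inK -> n1 \in inK ->
  m2 \in inK -> n2 \in inK -> C \in inK ->
  g + A0 * B0 = theta ^+ 2 * km + theta * kn ->
  r ^+ 2 = d + wtr g + tr g + kn / mu ->
  s1 ^+ 2 = P1 * R1 -> s2 ^+ 2 = P2 * R2 -> P1 * R2 + P2 * R1 = (theta * C) ^+ 2 ->
  A0 * R1 + B0 * P1 + s1 = theta ^+ 2 * m1 + theta * n1 ->
  A0 * R2 + B0 * P2 + s2 = theta ^+ 2 * m2 + theta * n2 ->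
  C != 0 ->
  conic n1 n2 (r ^+ 2 * mu + kn) (C ^+ 2) m1 m2 (r ^+ 2 * (1 + mu) + r + km)
    m2 m1 (C ^+ 2) != 0.
Proof.
move=> rK kmK knK m1K n1K m2K n2K CK ek er es1 es2 ec e1 e2 C0.
have CC0 : C ^+ 2 != 0 by rewrite expf_neq0.
have hh := @on_curve_conic A0 B0 d r km kn P1 R1 s1 m1 n1 P2 R2 s2 m2 n2 C
  (sqrt2 m2) (sqrt2 m1) (C ^+ 2) rK kmK knK m1K n1K m2K n2K CK (Ksqrt2 m2K) (Ksqrt2 m1K)
  (KX 2 CK) ek er es1 es2 ec e1 e2.
apply/eqP => eE; move: hh; rewrite /= !sqrt2K => hh.
case/hh: eE => s [hs _] {hh er ek}.
(* [A] and [B] are the coordinates of the nucleus [(m2, m1, C ^+ 2)] after scaling to h = 1. *)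
pose A := A0 + (m2 * P1 + m1 * P2) / C ^+ 2.
pose B := B0 + (m2 * R1 + m1 * R2) / C ^+ 2.
have eA : C ^+ 2 * A = m2 * P1 + m1 * P2 + C ^+ 2 * A0.
  by rewrite /A mulrDr [_ / _]mulrC mulVKf // addrC.
have eB : C ^+ 2 * B = m2 * R1 + m1 * R2 + C ^+ 2 * B0.
  by rewrite /B mulrDr [_ / _]mulrC mulVKf // addrC.
have eAB : (s / C ^+ 2) ^+ 2 + s / C ^+ 2 + g = A * B.
  apply: (mulfI (expf_neq0 2 CC0)).
  have e3 : C ^+ 2 * (s / C ^+ 2) = s by rewrite mulrC divfK.
  transitivity ((C ^+ 2 * A) * (C ^+ 2 * B)); last by char2_ring.
  rewrite eA eB -hs; move: e3; set s' := s / _ => e3; rewrite -e3; char2_ring.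
(* Passing from [(A0, B0)] to [(A, B)] adds [m1 * theta ^+ 2], which cancels the [theta ^+ 2]
   coordinate; the same happens with [m2] below. *)
have z1 : A * R1 + B * P1 + s1 = theta * n1.
  apply: (mulfI CC0).
  apply: (lincomb4 (k := R1) (k' := P1) (k2 := C ^+ 2) (k3 := m1) eA eB e1 ec); char2_ring.
have z2 : A * R2 + B * P2 + s2 = theta * n2.
  apply: (mulfI CC0).
  apply: (lincomb4 (k := R2) (k' := P2) (k2 := C ^+ 2) (k3 := m2) eA eB e2 ec); char2_ring.
have f1 : (A * R1 + B * P1) ^+ 2 + P1 * R1 = (theta * n1) ^+ 2.
  by rewrite -z1 -es1; char2_ring.
have f2 : (A * R2 + B * P2) ^+ 2 + P2 * R2 = (theta * n2) ^+ 2.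
  by rewrite -z2 -es2; char2_ring.
have [x [y [exy /negP[]]]] :=
  binary_form_isotropic (KX 2 n1K) (KX 2 n2K) (KX 2 CK) CC0.
have [] := @anisotropic A B _ (x * P1 + y * P2) (x * R1 + y * R2) eAB.
  apply: (lincomb4 (k := x ^+ 2) (k' := y ^+ 2) (k2 := x * y) (k3 := theta ^+ 2) f1 f2 ec exy);
    char2_ring.
have tC0 : (theta * C) ^+ 2 != 0 by rewrite expf_neq0 // mulf_neq0 // theta_neq0.
(* The determinant [P1 * R2 + P2 * R1] is [(theta * C) ^+ 2], which is nonzero, so the vanishing of
   both combinations forces x = y = 0. *)
move=> eP eR; rewrite xpair_eqE; apply/andP; split; apply/eqP; apply: (mulfI tC0); rewrite mulr0.
  apply: (lincomb3 (k := x) (k' := R2) (k2 := P2) ec eP eR); char2_ring.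
apply: (lincomb3 (k := y) (k' := R1) (k2 := P1) ec eP eR); char2_ring.
Qed.

(* A direction along which the conic varies by a nonzero square multiple: the
   nucleus, or any nonisotropic vector when the polar form vanishes. *)
Lemma conic_direction A0 B0 d r km kn P1 R1 s1 m1 n1 P2 R2 s2 m2 n2 C :
  r \in inK -> km \in inK -> kn \in inK -> m1 \in inK -> n1 \in inK ->
  m2 \in inK -> n2 \in inK -> C \in inK ->
  g + A0 * B0 = theta ^+ 2 * km + theta * kn ->
  r ^+ 2 = d + wtr g + tr g + kn / mu ->
  s1 ^+ 2 = P1 * R1 -> s2 ^+ 2 = P2 * R2 -> P1 * R2 + P2 * R1 = (theta * C) ^+ 2 ->
  A0 * R1 + B0 * P1 + s1 = theta ^+ 2 * m1 + theta * n1 ->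
  A0 * R2 + B0 * P2 + s2 = theta ^+ 2 * m2 + theta * n2 ->
  (forall x y, x \in inK -> y \in inK -> x * P1 + y * P2 = 0 -> x * R1 + y * R2 = 0 ->
     (x, y) = (0, 0)) ->
  exists a b c f, [/\ a \in inK, b \in inK, c \in inK, f \in inK & f != 0 /\
    forall x y h l,
    let E := conic n1 n2 (r ^+ 2 * mu + kn) (C ^+ 2) m1 m2 (r ^+ 2 * (1 + mu) + r + km) in
    E (x + l * a) (y + l * b) (h + l * c) = E x y h + l ^+ 2 * f].
Proof.
move=> rK kmK knK m1K n1K m2K n2K CK ek er es1 es2 ec e1 e2 indep.
set C0 := r ^+ 2 * mu + kn; set C2 := r ^+ 2 * (1 + mu) + r + km.
have C0K : C0 \in inK by rewrite /C0; inK.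
have C2K : C2 \in inK by rewrite /C2; inK.
have nuc : conic n1 n2 C0 (C ^+ 2) m1 m2 C2 m2 m1 (C ^+ 2) != 0 ->
  exists a b c f, [/\ a \in inK, b \in inK, c \in inK, f \in inK & f != 0 /\
    forall x y h l,
    let E := conic n1 n2 C0 (C ^+ 2) m1 m2 C2 in
    E (x + l * a) (y + l * b) (h + l * c) = E x y h + l ^+ 2 * f].
  move=> h; exists m2, m1, (C ^+ 2), (conic n1 n2 C0 (C ^+ 2) m1 m2 C2 m2 m1 (C ^+ 2)).
  split; [by []|by []|by inK|by rewrite /conic; inK|split=> // x y k l].
  by rewrite /conic; char2_ring.
have [C00|C00] := eqVneq C 0; last first.
  by apply: nuc; apply: conic_nucleus_nonsingular ek er es1 es2 ec e1 e2 C00.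
have par : P1 * R2 = P2 * R1.
  by apply: addr_eq0_char2; rewrite ec C00; char2_ring.
(* (A0 R + B0 P)^2 + P R is homogeneous over L, and the two vectors now lie on
   one L-line: a zero of the form on that line kills it there entirely. *)
have line x y : x \in inK -> y \in inK -> (x, y) != (0, 0) ->
    x * (A0 * R1 + B0 * P1 + s1) + y * (A0 * R2 + B0 * P2 + s2) = 0 ->
    (A0 * R1 + B0 * P1 + s1 = 0) /\ (A0 * R2 + B0 * P2 + s2 = 0).
  move=> xK yK xy0 h.
  pose P := x * P1 + y * P2; pose R := x * R1 + y * R2.
  have PR0 : P != 0 \/ R != 0.
    case: (eqVneq P 0) => [P0|]; last by left.
    case: (eqVneq R 0) => [R0|]; last by right.
    by case/negP: xy0; rewrite (indep _ _ xK yK P0 R0).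
  have hf : (A0 * R + B0 * P) ^+ 2 + P * R = 0.
    transitivity ((x * (A0 * R1 + B0 * P1 + s1) + y * (A0 * R2 + B0 * P2 + s2)) ^+ 2);
      last by rewrite h; char2_ring.
    apply: (lincomb3 (k := x ^+ 2) (k' := y ^+ 2) (k2 := x * y) es1 es2 par);
      rewrite /P /R; char2_ring.
  have key Pi Ri si : si ^+ 2 = Pi * Ri -> P * Ri = Pi * R -> A0 * Ri + B0 * Pi + si = 0.
    move=> esi pari; apply/eqP; rewrite -sqrf_eq0.
    have -> : (A0 * Ri + B0 * Pi + si) ^+ 2 = (A0 * Ri + B0 * Pi) ^+ 2 + Pi * Ri.
      by rewrite -esi; char2_ring.
    case: PR0 => [P0|R0].
      rewrite -(inj_eq (mulfI (expf_neq0 2 P0))) mulr0; apply/eqP.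
      apply: (lincomb2 (k := A0 ^+ 2 * (P * Ri + Pi * R) + P * Pi) (k' := Pi ^+ 2) pari hf);
        char2_ring.
    rewrite -(inj_eq (mulfI (expf_neq0 2 R0))) mulr0; apply/eqP.
    apply: (lincomb2 (k := B0 ^+ 2 * (P * Ri + Pi * R) + R * Ri) (k' := Ri ^+ 2) pari hf);
        char2_ring.
  split; apply: key => //; rewrite /P /R.
    by apply: (lincomb1 (k := y) par); char2_ring.
  by apply: (lincomb1 (k := x) par); char2_ring.
have zero_coord x y : x \in inK -> y \in inK -> (x, y) != (0, 0) ->
    x * m1 + y * m2 = 0 -> x * n1 + y * n2 = 0 -> [/\ m1 = 0, m2 = 0, n1 = 0 & n2 = 0].
  move=> xK yK xy0 hm hn; case: (line x y xK yK xy0).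
    by rewrite e1 e2; apply: (lincomb2 (k := theta ^+ 2) (k' := theta) hm hn); char2_ring.
  by rewrite e1 e2 => /(theta_indep m1K n1K)[-> ->] /(theta_indep m2K n2K)[-> ->].
(* As [C = 0], the value at the nucleus [(m2, m1, 0)] is (m2 n1 + m1 n2)^2. Were it zero,
   [zero_coord] at [(m2, m1)] would give m1 = m2 = 0. *)
case: (eqVneq (m2, m1) (0, 0)) => [[m20 m10]|m0]; last first.
  apply: nuc; apply/eqP => h.
  have hn : m2 * n1 + m1 * n2 = 0.
    by apply: sqr_inj; apply: (lincomb1 (k := 1) h); rewrite /conic C00; char2_ring.
  case: (zero_coord _ _ m2K m1K m0 _ hn); first by char2_ring.
  by move=> m10 m20; rewrite m10 m20 eqxx in m0.
(* From here E = (n1 x + n2 y + h C0)^2 + h^2 C2 has zero polar form, and any basis vector with a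
   nonzero value gives a direction. *)
have [n10|n10] := eqVneq n1 0; last first.
  exists 1, 0, 0, (n1 ^+ 2); split; [by inK|by inK|by inK|by inK|split=> [|x y h l]].
    by rewrite expf_neq0.
  by rewrite /conic C00 m20 m10; char2_ring.
have [n20|n20] := eqVneq n2 0; last first.
  exists 0, 1, 0, (n2 ^+ 2); split; [by inK|by inK|by inK|by inK|split=> [|x y h l]].
    by rewrite expf_neq0.
  by rewrite /conic C00 m20 m10; char2_ring.
exists 0, 0, 1, (C0 ^+ 2 + C2); split; [by inK|by inK|by inK|by inK|split=> [|x y h l]]; last first.
  by rewrite /conic C00 m20 m10; char2_ring.
(* If [(0, 0, 1)] were a zero, [(A0, B0)] would satisfy the curve equation. The anisotropic form
   there vanishes at [(P1, R1)], because [m1 = n1 = 0], so P1 = R1 = 0, against [indep]. *)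
apply/eqP => hC.
have /= [_] := @on_curve_conic A0 B0 d r km kn P1 R1 s1 m1 n1 P2 R2 s2 m2 n2 C
  0 0 1 rK kmK knK m1K n1K m2K n2K CK K0 K0 K1 ek er es1 es2 ec e1 e2.
case=> [|s [hs _]]; first by apply: (lincomb1 (k := 1) hC); rewrite /conic /C0 /C2; char2_ring.
have [] := @anisotropic A0 B0 s P1 R1.
- by apply: (lincomb1 (k := 1) hs); char2_ring.
- rewrite -es1 -sqrD e1 m10 n10; char2_ring.
move=> eP1 eR1; have := @indep 1 0 K1 K0; rewrite eP1 eR1 => h.
have /eqP : (1, 0) = (0, 0) :> L * L by apply: h; char2_ring.
by rewrite xpair_eqE oner_eq0.
Qed.

(** * Vectors of Sigma and the points of O *)

Implicit Types u v : 'cV[L]_6.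
Notation sv := (sigma_vec q).

Definition sig (a d b h : L) : 'cV[L]_6 := cv6 [:: a; bar a; d; b; bar b; h].

Lemma cv6E (s : seq L) (i : 'I_6) : cv6 s i 0 = nth 0 s i.
Proof. by rewrite mxE. Qed.

Lemma sv_sig a d b h : d \in inK -> h \in inK -> sv (sig a d b h).
Proof.
move=> /inKP dK /inKP hK; rewrite /sigma_vec !cv6E /= -/(bar a) -/(bar b) -/(bar d) -/(bar h).
by rewrite dK hK !eqxx.
Qed.

Lemma svP v : reflect [/\ v = sig (v 0 0) (v 2 0) (v 3 0) (v 5 0), v 2 0 \in inK & v 5 0 \in inK]
  (sv v).
Proof.
apply: (iffP idP) => [/and4P[/eqP h1 /eqP h4 h2 h5]|[ev k2 k5]]; last by rewrite ev; exact: sv_sig.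
split=> //; apply/colP=> i; rewrite cv6E.
case: i => [[|[|[|[|[|[|//]]]]]] hi] /=; rewrite -?[bar _]h1 -?[bar _]h4;
  by congr (v _ 0); apply: val_inj.
Qed.

Definition curve_vec (v : 'cV[L]_6) := [exists s,
  (s ^+ 2 + s * v 5 0 + g * v 5 0 ^+ 2 == w * v 0 0 * (w * bar (v 3 0) + bar w * v 5 0)) &&
  (v 2 0 == wtr (s + g * v 5 0) + tr g * v 5 0)].

Lemma curveP v : reflect (on_curve (w * v 0 0) (w * bar (v 3 0) + bar w * v 5 0) (v 2 0) (v 5 0))
  (curve_vec v).
Proof.
apply: (iffP existsP) => [[s /andP[/eqP h1 /eqP h2]]|[s [h1 h2]]]; exists s => //.
by rewrite h1 h2 !eqxx.
Qed.

Lemma on_curve0 A B D : on_curve A B D 0 <-> D = wtr (sqrt2 (A * B)).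
Proof.
split=> [[s [h1 ->]]|->].
  have -> : sqrt2 (A * B) = s by apply: sqr_inj; rewrite sqrt2K -h1; char2_ring.
  by rewrite !mulr0 !addr0.
by exists (sqrt2 (A * B)); rewrite sqrt2K !mulr0 expr0n /= !mulr0 !addr0.
Qed.

(** The quadratic equation leaves only s' = s or s' = s + h, and D tells these apart because [wtr h]
    is h / mu^2. *)
Lemma on_curve_unique A B D h s s' : h \in inK ->
  s ^+ 2 + s * h + g * h ^+ 2 = A * B -> D = wtr (s + g * h) + tr g * h ->
  s' ^+ 2 + s' * h + g * h ^+ 2 = A * B -> D = wtr (s' + g * h) + tr g * h -> s = s'.
Proof.
move=> hK h1 h2 h3 h4; have e1 : (s + s') * (s + s' + h) = 0.
  by apply: (lincomb2 (k := 1) (k' := 1) h1 h3); char2_ring.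
move/eqP: e1; rewrite mulf_eq0 => /orP[/eqP/addr_eq0_char2 //|/eqP e1].
have : wtr (s + s') = 0.
  by rewrite wtrD; move: h2; rewrite h4 !wtrD => h2; apply: (lincomb1 (k := 1) h2); char2_ring.
rewrite (addr_eq0_char2 e1) -[h]mulr1 wtrZ //.
have : wtr 1 = mu ^-2.
  have -> : 1 = theta ^+ 2 * (1 / mu) + theta * (1 / mu).
    by rewrite -mulrDl -muD mul1r divff // mu_neq0.
  by rewrite wtr_theta; [rewrite expr2 invfM mul1r | inK | inK].
move=> -> /eqP; rewrite mulf_eq0 invr_eq0 expf_eq0 (negPf mu_neq0) /= orbF => /eqP h0.
by apply: addr_eq0_char2; rewrite (addr_eq0_char2 e1).
Qed.

(** * Scalars, projective points, and counting along lines *)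

Lemma coordZ x u i : (x *: u) i 0 = x * u i 0. Proof. exact: mxE. Qed.
Lemma coordD u v i : (u + v) i 0 = u i 0 + v i 0. Proof. exact: mxE. Qed.

Lemma svD u v : sv u -> sv v -> sv (u + v).
Proof.
move=> /and4P[/eqP a1 /eqP a2 /eqP a3 /eqP a4] /and4P[/eqP b1 /eqP b2 /eqP b3 /eqP b4].
rewrite /sigma_vec !coordD a1 a2 b1 b2 -![(_ + _) ^+ q]/(bar _) !barD -!/(bar _) /bar a3 a4 b3 b4.
by rewrite !eqxx.
Qed.

Lemma svZ x u : x \in inK -> sv u -> sv (x *: u).
Proof.
move=> /inKP xK /and4P[/eqP a1 /eqP a2 /eqP a3 /eqP a4].
by rewrite /sigma_vec !coordZ a1 a2 !exprMn a3 a4 -/(bar x) xK !eqxx.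
Qed.

Lemma curveZ x u : x \in inK -> curve_vec u -> curve_vec (x *: u).
Proof.
move=> xK /curveP[s [h1 h2]]; apply/curveP; exists (x * s); rewrite !coordZ; split.
  rewrite barM (inKP _ xK); apply: (lincomb1 (k := x ^+ 2) h1); char2_ring.
have -> : x * s + g * (x * u 5 0) = x * (s + g * u 5 0) by char2_ring.
by rewrite (wtrZ _ xK) h2; char2_ring.
Qed.

(** The cone over O: it consists of vectors, and each point of O accounts for q - 1 of them. *)
Definition oval : {set 'cV[L]_6} := [set v | [&& v != 0, sv v & curve_vec v]].

Definition scal_closed (Z : {set 'cV[L]_6}) :=
  forall v x, v \in Z -> x \in inK -> x != 0 -> x *: v \in Z.

(** If x is not in K, comparing the equations of Sigma for [v] and [x *: v] forces every coordinate
    of [v] to vanish. *)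
Lemma sv_scalar v x : v != 0 -> sv v -> sv (x *: v) -> x \in inK.
Proof.
move=> v0 sv_v /and4P[/eqP]; move: (sv_v) => /and4P[/eqP h1 /eqP h4 /eqP h2 /eqP h5].
rewrite !coordZ h1 h4 !exprMn h2 h5 -!/(bar _) => c1 /eqP c4 /eqP c2' /eqP c5.
apply/inKP; apply/eqP; apply: contraNT v0 => xK.
have hz y : x * y = bar x * y -> y = 0.
  move=> e1; apply/eqP; have /eqP : (bar x + x) * y = 0.
    by apply: (lincomb1 (k := 1) e1); char2_ring.
  by rewrite mulf_eq0 addr_eq0 oppr_char2 (negPf xK).
have [-> _ _] := svP _ sv_v.
have z0 : v 0 0 = 0 by apply/eqP; rewrite -bar_eq0; apply/eqP/hz.
have z3 : v 3 0 = 0 by apply/eqP; rewrite -bar_eq0; apply/eqP/hz.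
rewrite z0 z3 (hz _ (esym c2')) (hz _ (esym c5)) /sig bar0.
by apply/eqP/colP=> i; rewrite cv6E mxE; case: i => [[|[|[|[|[|[|//]]]]]] hi].
Qed.

Lemma ptv_eqP u v : u != 0 -> v != 0 -> ptv u = ptv v <-> exists2 x, x != 0 & u = x *: v.
Proof.
move=> u0 v0; split=> [/genmxP/andP[/sub_rVP[x hx] _]|[x x0 ->]].
  have {}hx : u = x *: v by apply: trmx_inj; rewrite hx linearZ.
  by exists x => //; apply: contraNneq u0 => x0; rewrite hx x0 scale0r.
by apply/genmxP/eqmxP; rewrite linearZ /=; apply: eqmx_scale.
Qed.

Lemma card_Kunits : #|[set x in inK | x != 0]| = q.-1.
Proof.
have := cardsD1 0 [set x in inK]; rewrite cardsE card_K inE K0 add1n => ->.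
by apply: eq_card => x; rewrite !inE andbC.
Qed.

(** By [sv_scalar], the vectors of Z representing a given point are the q - 1 nonzero K-multiples of
    one of them. *)
Lemma card_points (Z : {set 'cV[L]_6}) : scal_closed Z ->
  (forall v, v \in Z -> v != 0 /\ sv v) -> #|Z| = (q.-1 * #|[set ptv v | v in Z]|)%N.
Proof.
move=> Zcl Zs; apply: card_fibers => v vZ; have [v0 sv_v] := Zs v vZ.
rewrite -card_Kunits.
rewrite -(card_imset (mem [set x in inK | x != 0]) (f := fun x => x *: v)).
  apply: eq_card => u; rewrite inE; apply/andP/imsetP.
    case=> uZ /eqP; have [u0 sv_u] := Zs u uZ; case/(ptv_eqP u0 v0) => x x0 eu.
    exists x => //; rewrite !inE x0 andbT; apply: (sv_scalar v0 sv_v); by rewrite -eu.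
  case=> x; rewrite !inE => /andP[xK x0] ->; have uZ := Zcl _ _ vZ xK x0; split=> //.
  by apply/eqP/ptv_eqP => //; [have [] := Zs _ uZ | exists x].
move=> x y /eqP; rewrite -subr_eq0 -scalerBl scaler_eq0 (negPf v0) orbF subr_eq0.
by move/eqP.
Qed.

Lemma oval_scal_closed : scal_closed oval.
Proof.
move=> v x; rewrite !inE => /and3P[v0 h1 h2] xK x0.
by rewrite scaler_eq0 negb_or x0 v0 svZ // curveZ.
Qed.

(** Each coset v + K m in U meets Y exactly once, so (x, u) -> u + x m is a bijection from K x Y to
    U. *)
Lemma card_translate (U Y : {set 'cV[L]_6}) m :
  (forall v x, v \in U -> x \in inK -> v + x *: m \in U) -> Y \subset U ->
  (forall v, v \in U -> exists2 x, x \in inK & v + x *: m \in Y) ->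
  (forall v x, v \in Y -> x \in inK -> v + x *: m \in Y -> x = 0) ->
  #|U| = (q * #|Y|)%N.
Proof.
move=> Ucl /subsetP YU ex uni.
have cancelm (v : 'cV[L]_6) x : v + x *: m + x *: m = v.
  by rewrite -addrA -scalerDl addxx scale0r addr0.
rewrite -card_K -[X in (X * _)%N]cardsE -cardsX.
rewrite -(card_in_imset (f := fun p : L * 'cV[L]_6 => p.2 + p.1 *: m)).
  apply: eq_card => v; apply/idP/imsetP.
    move=> vU; have [x xK xY] := ex v vU; exists (x, v + x *: m) => /=; last by rewrite cancelm.
    by rewrite !inE xY andbT.
  by case=> -[x u]; rewrite !inE /= => /andP[xK uY] ->; apply: Ucl => //; apply: YU.
move=> [x u] [y v]; rewrite !inE /= => /andP[xK uY] /andP[yK vY] h.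
have xy0 : y + x = 0.
  apply: (uni v) => //; first exact: KD.
  by rewrite scalerDl addrA -h cancelm.
have exy := addr_eq0_char2 xy0; rewrite exy in h *; congr (_, _).
by rewrite -(cancelm u x) h cancelm.
Qed.

(** In the coordinates (A, h, B) this is the form g X^2 + X Y + Y^2 after the substitution X -> a X
    + b Y, Y -> c X + d Y, whose determinant is 1. *)
Lemma Mabcd_Sgamma a b c d : a * d + b * c = 1 ->
  Mabcd q w a b c d *m Sgamma q w g =
  sig ((a ^+ 2 * g + a * c + c ^+ 2) / w)
    (wtr (a * b * g + c * d + b * c + g) + tr g)
    (bar ((b ^+ 2 * g + b * d + d ^+ 2 + bar w) / w)) 1.
Proof.
move=> det1.
have det1' : bar a * bar d + bar b * bar c = 1 by rewrite -!barM -barD det1 bar1.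
have hw : w * w^-1 = 1 by rewrite divff ?w_neq0.
have hw' : bar w * (bar w)^-1 = 1 by rewrite divff // bar_eq0 w_neq0.
have e2 x : x ^+ (2 * q) = bar x ^+ 2 by rewrite mulnC exprM.
apply/colP=> i; rewrite cv6E mxE !big_ord_recl big_ord0 !cv6E !mxE.
case: i => [[|[|[|[|[|[|//]]]]]] hi] /=;
  rewrite ?e2 ?exprS -?/(bar _) ?barK ?(mul0r, mulr0, add0r, addr0, mul1r, mulr1, invfM).
- apply: (lincomb1 (k := c ^+ 2) hw); rewrite bar_w; char2_ring.
- rewrite !(barD, barM, barV); move: hw'; set j := (bar w)^-1 => hw'.
  apply: (lincomb1 (k := bar c ^+ 2) hw'); rewrite bar_w; char2_ring.
- rewrite /wtr /tr !(barD, barM); move: hw hw'; set i := w^-1; set j := (bar w)^-1 => hw hw'.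
  apply: (lincomb4 (k := g + c * d + j) (k' := bar g + bar c * bar d + i) (k2 := i) (k3 := j)
    hw hw' det1 det1'); rewrite bar_w; char2_ring.
- rewrite !(barD, barM, barV) barK; move: hw'; set j := (bar w)^-1 => hw'.
  apply: (lincomb1 (k := bar d ^+ 2) hw'); rewrite bar_w; char2_ring.
- apply: (lincomb1 (k := d ^+ 2) hw); rewrite bar_w; char2_ring.
by [].
Qed.

(** At h = 0 the curve prescribes d as the trace of the square root of alpha beta^q; squaring gives
    the equation of Q. *)
Lemma curve_vec_quadric v : sv v -> v 5 0 = 0 ->
  curve_vec v = (v 2 0 ^+ 2 + v 0 0 * v 4 0 + v 1 0 * v 3 0 == 0).
Proof.
move=> /and4P[/eqP h1 /eqP h4 _ _] h5.
have hs y : wtr (sqrt2 (w ^+ 2 * y)) = tr (sqrt2 y).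
  have -> : sqrt2 (w ^+ 2 * y) = w * sqrt2 y by apply: sqr_inj; rewrite exprMn !sqrt2K.
  by rewrite wtrE mulrC mulKf // w_neq0.
have trs y : tr (sqrt2 y) ^+ 2 = tr y by rewrite /tr sqrD -barX sqrt2K.
apply/curveP/eqP; rewrite h5 h1 h4 -!/(bar _) mulr0 addr0.
  move/on_curve0 => ->.
  have -> : w * v 0 0 * (w * bar (v 3 0)) = w ^+ 2 * (v 0 0 * bar (v 3 0)) by char2_ring.
  by rewrite hs trs /tr barM barK; char2_ring.
move=> h; apply/on_curve0; apply: sqr_inj.
have -> : w * v 0 0 * (w * bar (v 3 0)) = w ^+ 2 * (v 0 0 * bar (v 3 0)) by char2_ring.
by rewrite hs trs; apply: (lincomb1 (k := 1) h); rewrite /tr barM barK; char2_ring.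
Qed.

Lemma orbit_in_oval a b c d : a * d + b * c = 1 ->
  Mabcd q w a b c d *m Sgamma q w g \in oval.
Proof.
move=> det1; rewrite Mabcd_Sgamma // inE; apply/and3P; split.
- by apply/eqP => /matrixP/(_ 5 0)/eqP; rewrite cv6E mxE oner_eq0.
- by apply: sv_sig; inK.
apply/curveP; rewrite !cv6E /=; exists (a * b * g + c * d + b * c); split; last first.
  by rewrite !mulr1.
rewrite barK [w * (_ / w)]mulrC divfK ?w_neq0 // [w * (_ / w)]mulrC divfK ?w_neq0 //.
apply: (lincomb1 (k := g * (a * d + b * c + 1) + a * b * g + c * d + b * c) det1); char2_ring.
Qed.

Lemma oval_in_orbit v : v \in oval -> v 5 0 = 1 ->
  exists a b c d, a * d + b * c = 1 /\ v = Mabcd q w a b c d *m Sgamma q w g.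
Proof.
rewrite inE => /and3P[_ /svP[ev _ _] /curveP[s [hs hd]]] h5; rewrite h5 in ev hs hd.
move: hs hd; set A := w * v 0 0; set B := _ + bar w * 1 => hs hd.
have A0 : A != 0.
  apply: contraTneq (g_noroot s) => A0; rewrite negbK; apply/eqP.
  by apply: (lincomb1 (k := 1) hs); rewrite A0; char2_ring.
pose t := sqrt2 A; have t0 : t != 0 by rewrite -sqrf_eq0 sqrt2K.
have tV : t * t^-1 = 1 by rewrite divff.
(* With a = 0, the equations c^2 = A, b c = 1 and c d + b c = s determine c, b and d in turn. *)
exists 0, t^-1, t, ((s + 1) / t).
have det1 : 0 * ((s + 1) / t) + t^-1 * t = 1 by apply: (lincomb1 (k := 1) tV); char2_ring.
split=> //; rewrite Mabcd_Sgamma // [LHS]ev.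
set u := t^-1 in tV *.
congr (sig _ _ _ _).
- have -> : 0 ^+ 2 * g + 0 * t + t ^+ 2 = A by rewrite sqrt2K; char2_ring.
  by rewrite /A mulrC mulKf ?w_neq0.
- rewrite hd !mulr1; congr (wtr _ + _).
  by apply: (lincomb1 (k := s) tV); char2_ring.
have -> : u ^+ 2 * g + u * ((s + 1) * u) + ((s + 1) * u) ^+ 2 = B.
  apply: (mulfI (expf_neq0 2 t0)).
  have tA : t ^+ 2 = A := sqrt2K A.
  apply: (lincomb3 (k := (g + (s + 1) + (s + 1) ^+ 2) * (t * u + 1)) (k' := 1) (k2 := B) tV hs tA);
    char2_ring.
have -> : B + bar w = w * bar (v 3 0) by rewrite /B; char2_ring.
by rewrite [w * _]mulrC mulfK ?w_neq0 // barK.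
Qed.

Lemma Oset_oval : Oset q w g = [set ptv v | v in oval].
Proof.
apply/setP => P; rewrite in_setU; apply/orP/imsetP.
  case=> /imsetP.
    case=> v; rewrite inE => /and4P[v0 sv_v /eqP h5 hq] ->; exists v => //.
    by rewrite inE v0 sv_v curve_vec_quadric.
  case=> p; rewrite inE => /eqP det1 ->; eexists; last by reflexivity.
  exact: orbit_in_oval.
case=> v vO ->; move: (vO); rewrite inE => /and3P[v0 sv_v cv_v].
have [h5|h5] := eqVneq (v 5 0) 0.
  left; apply/imsetP; exists v => //; rewrite inE v0 sv_v h5 eqxx /=.
  by rewrite -curve_vec_quadric.
right; have [_ _ k5] := svP _ sv_v.
have h5V : (v 5 0)^-1 != 0 by rewrite invr_eq0.
have [|a [b [c [d [det1 ev]]]]] := oval_in_orbit (oval_scal_closed vO (KV k5) h5V).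
  by rewrite coordZ mulVf.
apply/imsetP; exists (a, b, c, d); first by rewrite inE det1.
rewrite /= -ev; apply/ptv_eqP => //; first by rewrite scaler_eq0 negb_or h5V.
by exists (v 5 0) => //; rewrite scalerA divff // scale1r.
Qed.

(** * The number of vectors in the cone over O *)

Lemma q_gt1 : (1 < q)%N.
Proof.
by rewrite q_pow2 expnS; case: (2 ^ e)%N (expn_gt0 2 e) => //= k _; rewrite mulnS.
Qed.

Lemma sig_inj a d b h a' d' b' h' : sig a d b h = sig a' d' b' h' ->
  [/\ a = a', d = d', b = b' & h = h'].
Proof.
move=> E; have co (i : 'I_6) := congr1 (fun v : 'cV[L]_6 => v i 0) E.
by move: (co 0) (co 2) (co 3) (co 5); rewrite !cv6E.
Qed.

Lemma sqrt2_0 : sqrt2 0 = 0. Proof. by apply: sqr_inj; rewrite sqrt2K expr0n. Qed.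

Lemma card_oval_h0 : #|[set v in oval | v 5 0 == 0]| = (q ^ 4).-1.
Proof.
pose f (p : L * L) := sig p.1 (wtr (sqrt2 (w * p.1 * (w * bar p.2)))) p.2 0.
have f_inj : injective f by move=> [a b] [a' b'] /sig_inj[/= -> _ -> _].
transitivity #|f @: [set~ (0, 0)]|; last first.
  by rewrite card_imset // cardsC1 card_prod card_L -expnD.
apply: eq_card => v; apply/idP/imsetP.
  rewrite !inE => /andP[/and3P[v0 sv_v /curveP cv_v] /eqP h5].
  have [ev _ _] := svP _ sv_v; move: cv_v; rewrite h5 mulr0 addr0 => /on_curve0 z2.
  exists (v 0 0, v 3 0); last by rewrite /f [LHS]ev h5 z2.
  rewrite !inE; apply: contraNneq v0 => -[z0 z3].
  rewrite ev h5 z2 z0 z3 mulr0 mul0r sqrt2_0 /wtr bar0 !mul0r addr0 /sig bar0.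
  by apply/eqP/colP=> i; rewrite cv6E mxE; case: i => [[|[|[|[|[|[|//]]]]]] hi].
case=> -[a b]; rewrite !inE => ab0 ->; rewrite /f cv6E /= eqxx andbT.
apply/and3P; split.
- apply: contraNneq ab0 => /colP E; move: (E 0) (E 3); rewrite !cv6E !mxE /= => -> ->.
  by [].
- by apply: sv_sig; inK.
by apply/curveP; rewrite !cv6E /= mulr0 addr0; apply/on_curve0.
Qed.

(** If h is nonzero then so is A, since otherwise s / h would be a root of X^2 + X + g. Hence (A, s,
    h) are free parameters with B = [N] / A, and [on_curve_unique] recovers s from the vector. *)
Lemma card_oval_h1 : #|[set v in oval | v 5 0 != 0]| = ((q ^ 2).-1 * q ^ 2 * q.-1)%N.
Proof.
pose N (p : L * L * L) := p.1.2 ^+ 2 + p.1.2 * p.2 + g * p.2 ^+ 2.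
pose f (p : L * L * L) := sig (p.1.1 / w) (wtr (p.1.2 + g * p.2) + tr g * p.2)
  (bar ((N p / p.1.1 + bar w * p.2) / w)) p.2.
pose X : {set L * L * L} := setX (setX [set~ (0 : L)] [set: L]) [set x in inK | x != 0].
have wK x : w * (x / w) = x by rewrite mulrC divfK ?w_neq0.
have f_inj : {in X &, injective f}.
  move=> [[a s] h] [[a' s'] h']; rewrite !inE /= => /andP[/andP[a0 _] /andP[hK h0]] _.
  case/sig_inj => /= /(congr1 (fun x => w * x)) ea ed /(congr1 bar) eb eh.
  rewrite !wK in ea; subst a' h'; rewrite !barK in eb.
  move/(congr1 (fun x => w * x)): eb; rewrite !wK => /addIr eb.
  have aK x : a * (x / a) = x by rewrite mulrC divfK.
  congr (_, _, _); apply: (@on_curve_unique a (N (a, s, h) / a) _ h _ _ hK _ erefl _ ed).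
    by rewrite aK.
  by rewrite eb aK.
transitivity #|f @: X|; last first.
  by rewrite card_in_imset // !cardsX cardsC1 cardsT card_L card_Kunits.
apply: eq_card => v; apply/idP/imsetP.
  rewrite !inE => /andP[/and3P[_ sv_v /curveP[s [hs hd]]] h5].
  have [ev _ k5] := svP _ sv_v.
  have A0 : w * v 0 0 != 0.
    apply: contraTneq (g_noroot (s / v 5 0)) => A0; rewrite negbK.
    rewrite A0 mul0r in hs; rewrite -(inj_eq (mulfI (expf_neq0 2 h5))) mulr0 -[X in _ == X]hs.
    have hV : v 5 0 * (s / v 5 0) = s by rewrite mulrC divfK.
    apply/eqP; apply: (lincomb1 (k := v 5 0 * (s / v 5 0) + s + v 5 0) hV); char2_ring.
  exists (w * v 0 0, s, v 5 0); first by rewrite !inE /= A0 h5 k5.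
  rewrite [LHS]ev /f /N /= hd hs; congr (sig _ _ _ _).
    by rewrite mulrC mulKf ?w_neq0.
  rewrite [_ * (_ + _) / _]mulrAC divff // mul1r.
  have -> : w * bar (v 3 0) + bar w * v 5 0 + bar w * v 5 0 = w * bar (v 3 0) by char2_ring.
  by rewrite mulrC mulKf ?w_neq0 // barK.
case=> -[[a s] h]; rewrite !inE /= => /andP[/andP[a0 _] /andP[hK h0]] ->.
rewrite /f /= cv6E /= h0 andbT; apply/and3P; split.
- by apply: contraNneq h0 => /colP/(_ 5); rewrite cv6E mxE /= => ->.
- by apply: sv_sig; inK.
apply/curveP; rewrite !cv6E /=; exists s; split=> //.
rewrite barK !wK.
have -> : N (a, s, h) / a + bar w * h + bar w * h = N (a, s, h) / a by char2_ring.
by rewrite [RHS]mulrC divfK.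
Qed.

Lemma card_oval : #|oval| = (q.-1 * (q.+1 * (q ^ 3).+1))%N.
Proof.
have -> : #|oval| = (#|[set v in oval | v 5 0 == 0]%R| + #|[set v in oval | v 5 0 != 0]%R|)%N.
  rewrite -[LHS](cardsID [set v : 'cV[L]_6 | v 5 0 == 0]); congr addn; apply: eq_card => v.
    by rewrite !inE.
  by rewrite !inE andbC.
rewrite card_oval_h0 card_oval_h1; case: q q_gt1 => [//|m] _.
rewrite !expnS expn0; nia.
Qed.

(** * Generators *)

Definition kspan (u1 u2 u3 : 'cV[L]_6) : {set 'cV[L]_6} :=
  [set v | [exists p : L * L * L, [&& p.1.1 \in inK, p.1.2 \in inK, p.2 \in inK &
     v == p.1.1 *: u1 + p.1.2 *: u2 + p.2 *: u3]]].

Lemma kspanP u1 u2 u3 v : reflect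
  (exists x y z, [/\ x \in inK, y \in inK, z \in inK & v = x *: u1 + y *: u2 + z *: u3])
  (v \in kspan u1 u2 u3).
Proof.
rewrite inE; apply: (iffP existsP) => [[[[x y] z] /and4P[xK yK zK /eqP ->]]|].
  by exists x, y, z.
by case=> x [y [z [xK yK zK ->]]]; exists (x, y, z); rewrite /= xK yK zK eqxx.
Qed.

Lemma kspanD u1 u2 u3 u v :
  u \in kspan u1 u2 u3 -> v \in kspan u1 u2 u3 -> u + v \in kspan u1 u2 u3.
Proof.
move=> /kspanP[x [y [z [xK yK zK ->]]]] /kspanP[x' [y' [z' [xK' yK' zK' ->]]]].
apply/kspanP; exists (x + x'), (y + y'), (z + z'); split; [by inK|by inK|by inK|].
by rewrite !scalerDl; apply/colP => i; rewrite !coordD; char2_ring.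
Qed.

Lemma kspanZ u1 u2 u3 a u : a \in inK -> u \in kspan u1 u2 u3 -> a *: u \in kspan u1 u2 u3.
Proof.
move=> aK /kspanP[x [y [z [xK yK zK ->]]]].
apply/kspanP; exists (a * x), (a * y), (a * z); split; [by inK|by inK|by inK|].
by rewrite !scalerDr !scalerA.
Qed.

Lemma kspan_gen u1 u2 u3 :
  [/\ u1 \in kspan u1 u2 u3, u2 \in kspan u1 u2 u3 & u3 \in kspan u1 u2 u3].
Proof.
split; apply/kspanP.
- by exists 1, 0, 0; split; rewrite ?K0 ?K1 // !scale0r scale1r !addr0.
- by exists 0, 1, 0; split; rewrite ?K0 ?K1 // !scale0r scale1r addr0 add0r.
by exists 0, 0, 1; split; rewrite ?K0 ?K1 // !scale0r scale1r !add0r.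
Qed.

Lemma kspan_sub u1 u2 u3 v1 v2 v3 : v1 \in kspan u1 u2 u3 -> v2 \in kspan u1 u2 u3 ->
  v3 \in kspan u1 u2 u3 -> kspan v1 v2 v3 \subset kspan u1 u2 u3.
Proof.
move=> h1 h2 h3; apply/subsetP => _ /kspanP[x [y [z [xK yK zK ->]]]].
by apply: kspanD; [apply: kspanD|]; apply: kspanZ.
Qed.

Lemma kspan_sv u1 u2 u3 v : sv u1 -> sv u2 -> sv u3 -> v \in kspan u1 u2 u3 -> sv v.
Proof.
move=> h1 h2 h3 /kspanP[x [y [z [xK yK zK ->]]]].
by apply: svD; [apply: svD|]; apply: svZ.
Qed.

Definition kfree (u1 u2 u3 : 'cV[L]_6) := forall x y z,
  x \in inK -> y \in inK -> z \in inK -> x *: u1 + y *: u2 + z *: u3 = 0 ->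
  [/\ x = 0, y = 0 & z = 0].

Lemma kspan_imset u1 u2 u3 : kspan u1 u2 u3 =
  (fun p : L * L * L => p.1.1 *: u1 + p.1.2 *: u2 + p.2 *: u3) @:
    setX (setX [set x in inK] [set x in inK]) [set x in inK].
Proof.
apply/setP=> v; apply/kspanP/imsetP.
  case=> x [y [z [xK yK zK ->]]]; exists (x, y, z) => //.
  by rewrite !in_setX !in_set /= xK yK zK.
case=> -[[x y] z]; rewrite !in_setX !in_set /= => /andP[/andP[xK yK] zK] ->.
by exists x, y, z.
Qed.

Lemma card_kspanP u1 u2 u3 : #|kspan u1 u2 u3| = (q ^ 3)%N <-> kfree u1 u2 u3.
Proof.
have cX : (q ^ 3)%N = #|setX (setX [set x in inK] [set x in inK]) [set x in inK]|.
  by rewrite !cardsX cardsE card_K !expnSr mul1n.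
rewrite kspan_imset cX; split=> [/eqP/imset_injP inj x y z xK yK zK e1|free].
  have m1 : (x, y, z) \in setX (setX [set x in inK] [set x in inK]) [set x in inK].
    by rewrite !in_setX !in_set xK yK zK.
  have m0 : (0, 0, 0) \in setX (setX [set x in inK] [set x in inK]) [set x in inK].
    by rewrite !in_setX !in_set K0.
  have e0 : x *: u1 + y *: u2 + z *: u3 = 0 *: u1 + 0 *: u2 + 0 *: u3.
    by rewrite e1 !scale0r !addr0.
  by have [-> -> ->] := inj _ _ m1 m0 e0.
apply: card_in_imset => -[[x y] z] [[x' y'] z'].
rewrite !in_setX !in_set /= => /andP[/andP[xK yK] zK] /andP[/andP[xK' yK'] zK'] e1.
have [] := free (x + x') (y + y') (z + z'); try exact: KD.
  apply/colP => i; move/colP/(_ i): e1; rewrite !(coordD, coordZ) mxE => e1.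
  by apply: (lincomb1 (k := 1) e1); char2_ring.
by move=> /addr_eq0_char2 -> /addr_eq0_char2 -> /addr_eq0_char2 ->.
Qed.

Lemma hform_sv u v : sv u -> sv v -> hform q w u v =
  tr (w * (u 0 0 * bar (v 3 0) + v 0 0 * bar (u 3 0)))
  + v 5 0 * (u 2 0 + tr (bar w * u 0 0)) + u 5 0 * (v 2 0 + tr (bar w * v 0 0)).
Proof.
move=> /and4P[/eqP a1 /eqP a4 /eqP a2 /eqP a5] /and4P[/eqP b1 /eqP b4 /eqP b2 /eqP b5].
have io (i : 'I_6) : inord i = i by apply: val_inj; rewrite /= inordK.
rewrite /hform (io 0) (io 1) (io 2) (io 3) (io 4) (io 5).
rewrite a1 a4 b1 b4 b2 b5 -!/(bar _) !barK /tr !(barD, barM) !barK; char2_ring.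
Qed.

Lemma wtr_w x : wtr (w * x) = tr x.
Proof. by rewrite wtrE mulrAC divff ?w_neq0 // mul1r. Qed.

(** The pole of the hyperplane h = 0, which is also the nucleus of the parabolic quadric Q. *)
Definition nucl : 'cV[L]_6 := sig 0 1 0 0.

(** At h = 0 the curve gives d as a function of alpha and beta, and adding multiples of [nucl]
    changes d alone; each coset of K [nucl] therefore has one solution. *)
Lemma card_curve_inf u1 u2 u3 : let U := kspan u1 u2 u3 in
  sv u1 -> sv u2 -> sv u3 -> #|U| = (q ^ 3)%N -> (forall v, v \in U -> v 5 0 = 0) ->
  nucl \in U -> #|[set v in U | curve_vec v]| = (q ^ 2)%N.
Proof.
move=> U s1 s2 s3 cU U5 nU.
have Usv v : v \in U -> sv v by apply: kspan_sv.
have key v x : v \in U -> x \in inK -> curve_vec (v + x *: nucl) =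
    (x == v 2 0 + wtr (sqrt2 (w * v 0 0 * (w * bar (v 3 0))))).
  move=> vU xK; apply/curveP/eqP; rewrite !coordD !coordZ !cv6E /= (U5 _ vU) !(mulr0, addr0) mulr1.
    by move/on_curve0 => <-; rewrite addrA addxx add0r.
  by move=> ->; apply/on_curve0; rewrite addrA addxx add0r.
have cl v x : v \in U -> x \in inK -> v + x *: nucl \in U.
  by move=> vU xK; apply: kspanD => //; apply: kspanZ.
apply/eqP; rewrite -(eqn_pmul2l (ltnW q_gt1)) -expnS -cU.
rewrite -(@card_translate U _ nucl) //.
- by apply/subsetP=> v; rewrite in_set => /andP[].
- move=> v vU; exists (v 2 0 + wtr (sqrt2 (w * v 0 0 * (w * bar (v 3 0))))).
    by have [_ k2 _] := svP _ (Usv _ vU); inK.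
  have [_ k2 _] := svP _ (Usv _ vU).
  have xK : v 2 0 + wtr (sqrt2 (w * v 0 0 * (w * bar (v 3 0)))) \in inK by inK.
  by rewrite in_set cl // key // eqxx.
move=> v x; rewrite in_set => /andP[vU cv] xK; rewrite in_set => /andP[_]; rewrite key //.
have := key v 0 vU K0; rewrite scale0r addr0 cv => /esym/eqP <-.
by move/eqP.
Qed.

Lemma card_curve_affine w1 w2 v0 : let U := kspan w1 w2 v0 in
  sv w1 -> sv w2 -> sv v0 -> #|U| = (q ^ 3)%N ->
  w1 5 0 = 0 -> w2 5 0 = 0 -> v0 5 0 = 1 ->
  hform q w w1 w2 = 0 -> hform q w w1 v0 = 0 -> hform q w w2 v0 = 0 ->
  #|[set v in U | curve_vec v]| = (q ^ 2)%N.
Proof.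
move=> U s1 s2 s0 cU w15 w25 v05.
rewrite !hform_sv // w15 w25 v05 !mul0r !mul1r !addr0 => h12 h1 h2.
have free : kfree w1 w2 v0 by apply/card_kspanP.
pose P1 := w * w1 0 0; pose R1 := w * bar (w1 3 0).
pose P2 := w * w2 0 0; pose R2 := w * bar (w2 3 0).
pose A0 := w * v0 0 0; pose B0 := w * bar (v0 3 0) + bar w.
(* Isotropy of [w1] and [w2] places the polar form in the kernel [theta ^+ 2] K of [wtr], and every
   element of K is a square in K. *)
have [c cK ec] : exists2 c, c \in inK & P1 * R2 + P2 * R1 = (theta * c) ^+ 2.
  have [|c cK e1] := @wtr_eq0 (P1 * R2 + P2 * R1).
    rewrite -h12 -wtr_w; congr wtr; rewrite /P1 /P2 /R1 /R2; char2_ring.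
  by exists (sqrt2 c); [apply: Ksqrt2 | rewrite e1 exprMn sqrt2K].
(* Orthogonality to [v0] determines the third coordinates of [w1] and [w2]. *)
have d1 : w1 2 0 = wtr (A0 * R1 + B0 * P1).
  have -> : A0 * R1 + B0 * P1 =
    w * (w * (w1 0 0 * bar (v0 3 0) + v0 0 0 * bar (w1 3 0))) + w * (bar w * w1 0 0).
    by rewrite /A0 /B0 /R1 /P1; char2_ring.
  by rewrite wtrD !wtr_w; apply: (lincomb1 (k := 1) h1); char2_ring.
have d2 : w2 2 0 = wtr (A0 * R2 + B0 * P2).
  have -> : A0 * R2 + B0 * P2 =
    w * (w * (w2 0 0 * bar (v0 3 0) + v0 0 0 * bar (w2 3 0))) + w * (bar w * w2 0 0).
    by rewrite /A0 /B0 /R2 /P2; char2_ring.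
  by rewrite wtrD !wtr_w; apply: (lincomb1 (k := 1) h2); char2_ring.
have [m1 [n1 [m1K n1K e1]]] := theta_decomp (A0 * R1 + B0 * P1 + sqrt2 (P1 * R1)).
have [m2 [n2 [m2K n2K e2]]] := theta_decomp (A0 * R2 + B0 * P2 + sqrt2 (P2 * R2)).
have [km [kn [kmK knK ek]]] := theta_decomp (g + A0 * B0).
have [ev0 dK _] := svP _ s0.
have [r rK er] : exists2 r, r \in inK & r ^+ 2 = v0 2 0 + wtr g + tr g + kn / mu.
  by exists (sqrt2 (v0 2 0 + wtr g + tr g + kn / mu)); [apply: Ksqrt2; inK | rewrite sqrt2K].
(* By [d1] and [d2] the third coordinate depends K-linearly on P and R, so a combination with P = R
   = 0 is the zero vector. *)
have indep x y : x \in inK -> y \in inK -> x * P1 + y * P2 = 0 -> x * R1 + y * R2 = 0 ->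
    (x, y) = (0, 0).
  move=> xK yK eP eR.
  suff /(free _ _ _ xK yK K0)[-> -> _] : x *: w1 + y *: w2 + 0 *: v0 = 0 by [].
  rewrite scale0r addr0.
  have [-> _ _] := svP _ (svD (svZ xK s1) (svZ yK s2)).
  have z0 : (x *: w1 + y *: w2) 0 0 = 0.
    rewrite coordD !coordZ; apply: (mulfI w_neq0).
    by apply: (lincomb1 (k := 1) eP); rewrite /P1 /P2; char2_ring.
  have z3 : (x *: w1 + y *: w2) 3 0 = 0.
    apply/eqP; rewrite -bar_eq0; apply/eqP; rewrite coordD !coordZ barD !barM
      (inKP _ xK) (inKP _ yK).
    apply: (mulfI w_neq0).
    by apply: (lincomb1 (k := 1) eR); rewrite /R1 /R2; char2_ring.
  have z2 : (x *: w1 + y *: w2) 2 0 = 0.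
    rewrite coordD !coordZ d1 d2 -!wtrZ // -wtrD.
    have -> : x * (A0 * R1 + B0 * P1) + y * (A0 * R2 + B0 * P2) = 0.
      by apply: (lincomb2 (k := B0) (k' := A0) eP eR); char2_ring.
    by rewrite /wtr bar0 !mul0r addr0.
  have z5 : (x *: w1 + y *: w2) 5 0 = 0 by rewrite coordD !coordZ w15 w25; char2_ring.
  rewrite z0 z2 z3 z5 /sig bar0.
  by apply/colP=> i; rewrite cv6E mxE; case: i => [[|[|[|[|[|[|//]]]]]] hi].
have [a [b [c' [f [aK bK c'K fK [f0 hE]]]]]] := conic_direction rK kmK knK m1K n1K m2K n2K cK
  ek er (sqrt2K _) (sqrt2K _) ec e1 e2 indep.
move: hE; set E := conic _ _ _ _ _ _ _ => /= hE.
have curveE x y h : x \in inK -> y \in inK -> h \in inK ->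
    curve_vec (x *: w1 + y *: w2 + h *: v0) = (E x y h == 0).
  move=> xK yK hK.
  have := @on_curve_conic A0 B0 (v0 2 0) r km kn P1 R1 _ m1 n1 P2 R2 _ m2 n2 c
    (sqrt2 x) (sqrt2 y) h rK kmK knK m1K n1K m2K n2K cK (Ksqrt2 xK) (Ksqrt2 yK) hK
    ek er (sqrt2K _) (sqrt2K _) ec e1 e2.
  rewrite /= !sqrt2K -d1 -d2 -/E => hh.
  have -> : curve_vec (x *: w1 + y *: w2 + h *: v0) = (E x y h == 0) :> bool.
    apply/curveP/eqP; rewrite !coordD !coordZ w15 w25 v05 !mulr0 !add0r mulr1.
      move=> h3; apply/hh; move: h3; congr (on_curve _ _ _ _).
        by rewrite /P1 /P2 /A0; char2_ring.
      by rewrite !barD !barM (inKP _ xK) (inKP _ yK) (inKP _ hK) /R1 /R2 /B0; char2_ring.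
    move/hh; congr (on_curve _ _ _ _).
      by rewrite /P1 /P2 /A0; char2_ring.
    by rewrite !barD !barM (inKP _ xK) (inKP _ yK) (inKP _ hK) /R1 /R2 /B0; char2_ring.
  by [].
have EK x y h : x \in inK -> y \in inK -> h \in inK -> E x y h \in inK.
  by move=> xK yK hK; rewrite /E /conic; inK.
pose m := a *: w1 + b *: w2 + c' *: v0.
have mU : m \in U by apply/kspanP; exists a, b, c'.
have transl x y h l : x *: w1 + y *: w2 + h *: v0 + l *: m =
    (x + l * a) *: w1 + (y + l * b) *: w2 + (h + l * c') *: v0.
  by apply/colP => i; rewrite !(coordD, coordZ); char2_ring.
apply/eqP; rewrite -(eqn_pmul2l (ltnW q_gt1)) -expnS -cU.
have cl v l : v \in U -> l \in inK -> v + l *: m \in U.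
  by move=> vU lK; apply: kspanD => //; apply: kspanZ.
rewrite -(@card_translate U _ m) //.
- by apply/subsetP=> v; rewrite in_set => /andP[].
- move=> v vU; move: (vU) => /kspanP[x [y [h [xK yK hK ev]]]].
  have lK : sqrt2 (E x y h / f) \in inK by apply: Ksqrt2; apply: KM; [apply: EK | apply: KV].
  (* This is the unique zero in l of E(v) + l^2 f. *)
  exists (sqrt2 (E x y h / f)) => //; rewrite in_set cl //=.
  rewrite ev transl curveE; [|by inK..].
  by rewrite hE sqrt2K divfK // addxx.
move=> v l; rewrite in_set => /andP[vU cv] lK; rewrite in_set => /andP[_].
move: (vU) cv => /kspanP[x [y [h [xK yK hK ->]]]].
rewrite transl !curveE; [|by inK..] => /eqP e3.
rewrite hE e3 add0r mulf_eq0 (negPf f0) orbF expf_eq0 /= => /eqP.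
by [].
Qed.

Lemma kspan_swap23 u1 u2 u3 : kspan u1 u3 u2 = kspan u1 u2 u3.
Proof.
apply/eqP; rewrite eqEsubset; apply/andP; split; apply: kspan_sub.
all: by [case: (kspan_gen u1 u2 u3) | case: (kspan_gen u1 u3 u2)].
Qed.

Lemma kspan_swap13 u1 u2 u3 : kspan u3 u2 u1 = kspan u1 u2 u3.
Proof.
apply/eqP; rewrite eqEsubset; apply/andP; split; apply: kspan_sub.
all: by [case: (kspan_gen u1 u2 u3) | case: (kspan_gen u3 u2 u1)].
Qed.

(** If some basis vector has h nonzero, it is moved to the last place, scaled to h = 1, and used to
    clear h from the other two, which gives the affine case. *)
Lemma card_curve_kspan u1 u2 u3 : let U := kspan u1 u2 u3 in
  sv u1 -> sv u2 -> sv u3 -> #|U| = (q ^ 3)%N ->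
  {in U &, forall u v, hform q w u v = 0} ->
  ((forall v, v \in U -> v 5 0 = 0) -> nucl \in U) ->
  #|[set v in U | curve_vec v]| = (q ^ 2)%N.
Proof.
move=> U s1 s2 s3 cU iso hnucl.
have main v1 v2 v3 : sv v1 -> sv v2 -> sv v3 -> kspan v1 v2 v3 = U -> v3 5 0 != 0 ->
    #|[set v in U | curve_vec v]| = (q ^ 2)%N.
  move=> t1 t2 t3 eU h3.
  have [_ _ k3] := svP _ t3; have [_ _ k1] := svP _ t1; have [_ _ k2] := svP _ t2.
  have [g1 g2 g3] := kspan_gen v1 v2 v3; rewrite eU in g1 g2 g3.
  pose v0 := (v3 5 0)^-1 *: v3; pose w1 := v1 + v1 5 0 *: v0; pose w2 := v2 + v2 5 0 *: v0.
  have g0 : v0 \in U by apply: kspanZ => //; apply: KV.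
  have gw1 : w1 \in U by apply: kspanD => //; apply: kspanZ.
  have gw2 : w2 \in U by apply: kspanD => //; apply: kspanZ.
  have Usv v : v \in U -> sv v by apply: kspan_sv.
  have v05 : v0 5 0 = 1 by rewrite coordZ mulVf.
  have eU' : kspan w1 w2 v0 = U.
    apply/eqP; rewrite eqEsubset kspan_sub //= -eU.
    have [f1 f2 f0] := kspan_gen w1 w2 v0.
    have cancel v x : v = v + x *: v0 + x *: v0.
      by rewrite -addrA -scalerDl addxx scale0r addr0.
    apply: kspan_sub.
    - by rewrite (cancel v1 (v1 5 0)); apply: kspanD => //; apply: kspanZ.
    - by rewrite (cancel v2 (v2 5 0)); apply: kspanD => //; apply: kspanZ.
    have -> : v3 = v3 5 0 *: v0 by rewrite scalerA divff // scale1r.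
    exact: kspanZ.
  rewrite -eU'; apply: card_curve_affine; rewrite ?eU' ?iso ?Usv //.
    by rewrite coordD coordZ v05 mulr1 addxx.
  by rewrite coordD coordZ v05 mulr1 addxx.
have [z3|h3] := eqVneq (u3 5 0) 0; last exact: (main u1 u2 u3).
have [z2|h2] := eqVneq (u2 5 0) 0; last exact: (main u1 u3 u2 s1 s3 s2 (kspan_swap23 _ _ _) h2).
have [z1|h1] := eqVneq (u1 5 0) 0; last exact: (main u3 u2 u1 s3 s2 s1 (kspan_swap13 _ _ _) h1).
have U5 v : v \in U -> v 5 0 = 0.
  by case/kspanP=> [x [y [z [_ _ _ ->]]]]; rewrite !(coordD, coordZ) z1 z2 z3; char2_ring.
by apply: card_curve_inf => //; apply: hnucl.
Qed.

(** * Planes of Sigma: spans over L and over K *)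

Lemma span3P u1 u2 u3 v : reflect (exists x y z, v = x *: u1 + y *: u2 + z *: u3)
  (v^T <= span3 u1 u2 u3)%MS.
Proof.
apply: (iffP submxP) => [[D]|[x [y [z ->]]]].
  have [x [y [z eD]]] : exists x y z, D = row_mx x%:M (row_mx y%:M z%:M) :> 'M_(1, 1 + (1 + 1)).
    pose D' : 'M[L]_(1, 1 + (1 + 1)) := D.
    exists (lsubmx D' 0 0), (lsubmx (rsubmx D') 0 0), (rsubmx (rsubmx D') 0 0).
    by rewrite -!mx11_scalar !hsubmxK.
  rewrite eD /span3 (@mul_row_col _ 1 1 2 6) (@mul_row_col _ 1 1 1 6) !mul_scalar_mx addrA => ev.
  by exists x, y, z; apply: trmx_inj; rewrite ev !linearD !linearZ.
exists (row_mx x%:M (row_mx y%:M z%:M)); rewrite /span3.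
rewrite (@mul_row_col _ 1 1 2 6) (@mul_row_col _ 1 1 1 6) !mul_scalar_mx.
by rewrite !linearD !linearZ /= addrA.
Qed.

Lemma span3_free u1 u2 u3 x y z : \rank (span3 u1 u2 u3) = 3%N ->
  x *: u1 + y *: u2 + z *: u3 = 0 -> [/\ x = 0, y = 0 & z = 0].
Proof.
move=> rk e1; have fr : row_free (span3 u1 u2 u3) by rewrite /row_free rk.
pose D : 'M[L]_(1, 1 + (1 + 1)) := row_mx x%:M (row_mx y%:M z%:M).
have : (D : 'rV_3) *m span3 u1 u2 u3 = 0.
  rewrite /span3 (@mul_row_col _ 1 1 2 6) (@mul_row_col _ 1 1 1 6) !mul_scalar_mx.
  by rewrite addrA -!linearZ -!linearD /= e1 trmx0.
move/eqP; rewrite (mulmx_free_eq0 _ fr) => /eqP D0.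
have hx := congr1 (fun A : 'M[L]_(1, 1 + (1 + 1)) => lsubmx A 0 0) D0.
have hy := congr1 (fun A : 'M[L]_(1, 1 + (1 + 1)) => lsubmx (rsubmx A) 0 0) D0.
have hz := congr1 (fun A : 'M[L]_(1, 1 + (1 + 1)) => rsubmx (rsubmx A) 0 0) D0.
move: hx hy hz; rewrite /D !(row_mxKl, row_mxKr) !mxE /= !mulr1n => hx hy hz.
by split.
Qed.

(** Sigma consists of the vectors fixed by conjugating all entries and then permuting the
    coordinates by this involution. *)
Definition swap6 (i : 'I_6) : 'I_6 := nth 0 [:: 1; 0; 2; 4; 3; 5] i.
Lemma swap6K : involutive swap6.
Proof. by case=> [[|[|[|[|[|[|//]]]]]] hi]; apply: val_inj. Qed.
Lemma sv_swap v i : sv v -> v (swap6 i) 0 = bar (v i 0).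
Proof.
move=> sv_v; have [ev /inKP k2 /inKP k5] := svP _ sv_v; rewrite ev !cv6E.
by case: i => [[|[|[|[|[|[|//]]]]]] hi] /=; rewrite ?barK ?k2 ?k5.
Qed.

(** The semilinear involution fixing Sigma conjugates the coefficients of v over the three vectors;
    by independence over L they equal their conjugates. *)
Lemma span3_kspan u1 u2 u3 v : sv u1 -> sv u2 -> sv u3 -> \rank (span3 u1 u2 u3) = 3%N ->
  sv v -> (v^T <= span3 u1 u2 u3)%MS = (v \in kspan u1 u2 u3).
Proof.
move=> s1 s2 s3 rk sv_v; apply/span3P/kspanP => [[x [y [z ev]]]|]; last first.
  by case=> x [y [z [_ _ _ ->]]]; exists x, y, z.
exists x, y, z; suff [hx hy hz] : [/\ bar x + x = 0, bar y + y = 0 & bar z + z = 0].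
  by split=> //; apply/inKP; apply: addr_eq0_char2.
apply: (span3_free rk); apply/colP => i; rewrite !(coordD, coordZ) [RHS]mxE.
have := sv_swap (swap6 i) sv_v; rewrite swap6K {2}ev {1}ev !(coordD, coordZ) !(barD, barM).
rewrite -!sv_swap // !swap6K => h.
by apply: (lincomb1 (k := 1) h); char2_ring.
Qed.

(* The matrix of [hform] once the powers y^q are replaced, for y in Sigma, by
   the swapped coordinates. *)
Definition Jmx : 'M[L]_6 := \matrix_(i < 6, j < 6) nth 0 (nth [::]
  [:: [:: 0; 0; 0; 0; w; bar w];
      [:: 0; 0; 0; bar w; 0; w];
      [:: 0; 0; 0; 0; 0; 1];
      [:: 0; bar w; 0; 0; 0; 0];
      [:: w; 0; 0; 0; 0; 0];
      [:: bar w; w; 1; 0; 0; 0]] i) j.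

Lemma ord6E (T : Type) (f : 'I_6 -> T) :
  ((f (lift ord0 (lift ord0 (lift ord0 (lift ord0 (lift ord0 ord0))))) = f 5) *
   (f (lift ord0 (lift ord0 (lift ord0 (lift ord0 ord0)))) = f 4) *
   (f (lift ord0 (lift ord0 (lift ord0 ord0))) = f 3) *
   (f (lift ord0 (lift ord0 ord0)) = f 2) * (f (lift ord0 ord0) = f 1) * (f ord0 = f 0))%type.
Proof. by do !split; congr f; apply: val_inj. Qed.

Lemma row_free_Jmx : row_free Jmx.
Proof.
apply: inj_row_free => v hv.
have co j := congr1 (fun u : 'rV[L]_6 => u 0 j) hv.
have z5 := co 2; have z1 := co 3; have z0 := co 4; have z4 := co 0.
have z3 := co 1; have z2 := co 5.
move: z0 z1 z2 z3 z4 z5 => {co hv}.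
rewrite !mxE !big_ord_recl !big_ord0 !mxE /= !(mulr0, mul0r, addr0, add0r, mulr1) !(ord6E (v 0)).
have w0 x : x * w = 0 -> x = 0 by move/eqP; rewrite mulf_eq0 (negPf w_neq0) orbF => /eqP.
have w0' x : x * bar w = 0 -> x = 0.
  by move/eqP; rewrite mulf_eq0 bar_eq0 (negPf w_neq0) orbF => /eqP.
move=> /w0 z0 /w0' z1 z2 z3 z4 z5.
rewrite z0 z1 !mul0r !add0r in z2; rewrite z5 mul0r addr0 in z3; rewrite z5 mul0r addr0 in z4.
apply/rowP; case=> [[|[|[|[|[|[|//]]]]]] hi]; rewrite mxE.
- by rewrite -[RHS]z0; congr (v _ _); apply: val_inj.
- by rewrite -[RHS]z1; congr (v _ _); apply: val_inj.
- by rewrite -[RHS]z2; congr (v _ _); apply: val_inj.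
- by rewrite -[RHS](w0' _ z3); congr (v _ _); apply: val_inj.
- by rewrite -[RHS](w0 _ z4); congr (v _ _); apply: val_inj.
by rewrite -[RHS]z5; congr (v _ _); apply: val_inj.
Qed.

Lemma hform_Jmx u v : sv v -> u^T *m Jmx *m v = (hform q w u v)%:M.
Proof.
move=> /and4P[/eqP a1 /eqP a4 /eqP a2 /eqP a5].
have io (i : 'I_6) : inord i = i by apply: val_inj; rewrite /= inordK.
rewrite /hform (io 0) (io 1) (io 2) (io 3) (io 4) (io 5).
rewrite [LHS]mx11_scalar; congr (_%:M).
rewrite !mxE !big_ord_recl !big_ord0 !mxE !big_ord_recl !big_ord0 !mxE /=.
rewrite !(mulr0, mul0r, addr0, add0r, mulr1).
rewrite !(ord6E (u^~ 0)) !(ord6E (v^~ 0)) a1 a4 a2 a5 -!/(bar _) !barK; char2_ring.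
Qed.

(** Within h = 0, [nucl] is orthogonal to the whole plane, so the plane and [nucl] together span a
    totally isotropic space. In dimension six it has rank at most 3, hence it is the plane
    itself. *)
Lemma nucl_in_span u1 u2 u3 : sv u1 -> sv u2 -> sv u3 -> \rank (span3 u1 u2 u3) = 3%N ->
  (forall v, v \in kspan u1 u2 u3 -> v 5 0 = 0) ->
  {in kspan u1 u2 u3 &, forall u v, hform q w u v = 0} -> nucl \in kspan u1 u2 u3.
Proof.
move=> s1 s2 s3 rk z5 iso; have [g1 g2 g3] := kspan_gen u1 u2 u3.
have sn : sv nucl by apply: sv_sig; inK.
rewrite -span3_kspan //.
pose M := col_mx nucl^T (span3 u1 u2 u3).
have ns u : u \in kspan u1 u2 u3 -> hform q w u nucl = 0 /\ hform q w nucl u = 0.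
  move=> hu; have su := kspan_sv s1 s2 s3 hu.
  rewrite !hform_sv // !cv6E /= bar0 (z5 _ hu) !(mulr0, mul0r, addr0) /tr bar0 addr0.
  by [].
have nn : hform q w nucl nucl = 0.
  by rewrite !hform_sv // !cv6E /= bar0 !(mulr0, mul0r, addr0) /tr bar0 addr0.
have Mz v : v \in [:: nucl; u1; u2; u3] -> M *m Jmx *m v = 0.
  rewrite !inE => hv.
  have sv_v : sv v by case/or4P: hv => /eqP ->.
  rewrite /M /span3 !(@mul_col_mx _ 1 3) !(@mul_col_mx _ 1 2) !(@mul_col_mx _ 1 1).
  rewrite !hform_Jmx //.
  have -> : hform q w nucl v = 0.
    case/or4P: hv => /eqP ->; [exact: nn | exact: (ns _ g1).2 | exact: (ns _ g2).2 |].
    exact: (ns _ g3).2.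
  have hh u : u \in kspan u1 u2 u3 -> hform q w u v = 0.
    by move=> hu; case/or4P: hv => /eqP ->; [case: (ns _ hu) | exact: iso..].
  have e0 : 0%:M = 0 :> 'M[L]_1 by apply: raddf0.
  by rewrite !hh // e0 (@col_mx0 _ 1 1) (@col_mx0 _ 1 2) (@col_mx0 _ 1 3).
have M0 : M *m Jmx *m M^T = 0.
  rewrite {2}/M /span3 (@tr_col_mx _ 1 3) (@tr_col_mx _ 1 2) (@tr_col_mx _ 1 1) !trmxK.
  rewrite (@mul_mx_row _ _ _ 1 3) (@mul_mx_row _ _ _ 1 2) (@mul_mx_row _ _ _ 1 1)
    !Mz ?inE ?eqxx ?orbT //.
  by rewrite (@row_mx0 _ _ 1 1) (@row_mx0 _ _ 1 2) (@row_mx0 _ _ 1 3).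
(* As [Jmx] is invertible, [M0] bounds twice the rank of [M] by 6. *)
have := mulmx0_rank_max M0; rewrite mxrankMfree ?row_free_Jmx // mxrank_tr => rM.
have /andP[nM sM] : (nucl^T <= M)%MS && (span3 u1 u2 u3 <= M)%MS by rewrite -col_mx_sub.
apply: submx_trans nM _; rewrite -(geq_leqif (mxrank_leqif_sup sM)) rk.
lia.
Qed.

(** * The points of O, and those in a generator *)

Lemma sv_pt_Sigma v : v != 0 -> sv v -> ptv v \in Sigma L q.
Proof. by move=> v0 sv_v; apply/imsetP; exists v => //; rewrite inE v0. Qed.

Lemma card_Oset : #|Oset q w g| = (q.+1 * (q ^ 3).+1)%N.
Proof.
have q1 : (0 < q.-1)%N by rewrite -subn1 subn_gt0 q_gt1.
apply/eqP; rewrite -(eqn_pmul2l q1) -card_oval Oset_oval (card_points oval_scal_closed) //.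
by move=> v; rewrite inE => /and3P[].
Qed.

Lemma Oset_ovoid : m_ovoid q w q.+1 (Oset q w g).
Proof.
have q1 : (0 < q.-1)%N by rewrite -subn1 subn_gt0 q_gt1.
rewrite Oset_oval; split.
  apply/subsetP => _ /imsetP[v + ->]; rewrite inE => /and3P[v0 sv_v _].
  exact: sv_pt_Sigma.
move=> S [u1 [u2 [u3 [/and3P[s1 s2 s3] rk iso ->]]]].
pose U := kspan u1 u2 u3.
have Usv v : v \in U -> sv v by apply: kspan_sv.
have isoU : {in U &, forall u v, hform q w u v = 0}.
  by move=> u v uU vU; apply: iso; rewrite span3_kspan //; apply: Usv.
have cU : #|U| = (q ^ 3)%N.
  by apply/card_kspanP => x y z _ _ _; apply: span3_free.
have cC : #|[set v in U | curve_vec v]| = (q ^ 2)%N.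
  by apply: card_curve_kspan => // h5; apply: nucl_in_span.
(* The zero vector satisfies the curve condition and represents no point; without it q^2 - 1 = (q -
   1)(q + 1) vectors remain. *)
pose Z := [set v in U | curve_vec v] :\ 0.
have Zmem v : (v \in Z) = [&& v != 0, v \in U & curve_vec v].
  by rewrite in_setD1 in_set.
have -> : [set ptv v | v in oval] :&: [set P in Sigma L q | (P <= span3 u1 u2 u3)%MS] =
    [set ptv v | v in Z].
  apply/setP => P; rewrite in_setI; apply/andP/imsetP.
    case=> /imsetP[v + ->]; rewrite in_set => /and3P[v0 sv_v cv].
    rewrite in_set genmxE span3_kspan // => /andP[_ vU].
    by exists v => //; rewrite Zmem v0 cv andbT.
  case=> v; rewrite Zmem => /and3P[v0 vU cv] ->; have sv_v := Usv _ vU; split.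
    by apply/imsetP; exists v => //; rewrite in_set v0 sv_v.
  by rewrite in_set sv_pt_Sigma //= genmxE span3_kspan.
have Zcl : scal_closed Z.
  move=> v x; rewrite !Zmem => /and3P[v0 vU cv] xK x0.
  by rewrite scaler_eq0 negb_or x0 v0 kspanZ // curveZ.
have Zs v : v \in Z -> v != 0 /\ sv v.
  by rewrite Zmem => /and3P[v0 vU _]; split=> //; apply: Usv.
apply/eqP; rewrite -(eqn_pmul2l q1) -(card_points Zcl Zs); apply/eqP.
have C0 : 0 \in [set v in U | curve_vec v].
  have [g1 _ _] := kspan_gen u1 u2 u3.
  rewrite in_set; apply/andP; split; first by rewrite -(scale0r u1) kspanZ // K0.
  apply/curveP; rewrite !mxE bar0 !mulr0 addr0; apply/on_curve0.
  by rewrite mulr0 sqrt2_0 /wtr bar0 !mul0r addr0.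
have := cardsD1 0 [set v in U | curve_vec v]; rewrite C0 cC -/Z add1n => h.
have -> : #|Z| = (q ^ 2).-1 by rewrite h.
by case: q q_gt1 => [//|m] _; rewrite !expnS expn0; nia.
Qed.

End Ovoid.

(** A root x would make the factor X - x associate to the irreducible polynomial, although their
    sizes are 2 and 3. *)
Lemma irreducible_quadratic_noroot (F : fieldType) (g : F) :
  irreducible_poly ('X^2 + 'X + g%:P) -> forall x, x ^+ 2 + x + g != 0.
Proof.
move=> [_ irr] x; apply/eqP => hx.
have char2_ring_theory : root ('X^2 + 'X + g%:P) x by rewrite /root !hornerE hx.
have /eqp_size : 'X - x%:P %= 'X^2 + 'X + g%:P.
  by apply: irr; rewrite ?size_XsubC ?dvdp_XsubCl.
rewrite size_XsubC -addrA size_polyDl ?size_polyXn //.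
rewrite (leq_ltn_trans (size_polyD _ _)) // size_polyX size_polyC gtn_max.
by case: (g != 0).
Qed.

Theorem mainTheorem18 (L : finFieldType) (q : nat)
  (hq2 : exists e : nat, q = (2 ^ e.+1)%N) (hL : #|L| = (q ^ 2)%N)
  (w : L) (hw : w + w ^+ q = 1) (hwq : w ^+ q != w)
  (g : L) (hg : irreducible_poly ('X^2 + 'X + g%:P)) :
  m_ovoid q w q.+1 (Oset q w g) /\
  #|Oset q w g| = (q.+1 * (q ^ 3).+1)%N.
Proof.
have [e q_pow2] := hq2; have noroot := irreducible_quadratic_noroot hg.
split; first exact: Oset_ovoid q_pow2 hL hw noroot.
exact: card_Oset q_pow2 hL hw noroot.
Qed.
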